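(* Let the pair $(A,B)=(A_0,A_1)$ of hyperbolic toral automorphisms of determinant $+1$ satisfy the cone property, with rates $\lambda_{\mathcal E}>1$ and $\lambda_{\mathcal C}<1$. There exist $c>0$ and $\rho>0$ such that, if $f$ and $g$ are two observables satisfying the strong Hölder condition with exponent $\beta\in(0,1]$, then $$\sup_{\omega\in\Omega}|C_{f,g}(\omega,n)|\le c\,\|f\|_\beta\|g\|_\beta\,e^{-\rho\beta n} \quad\text{and}\quad \sup_{\omega\in\Omega}|C^\Phi_{f,g}(\omega,n)|\le c\,\|f\|_\beta\|g\|_\beta\,e^{-\rho\beta n}$$ hold for all $n\in\mathbb N$. In fact, one can take $\rho=\ln\min(\lambda_{\mathcal C}^{-1},\lambda_{\mathcal E})$. Moreover, for all $\epsilon>0$ there exists a constant $C(\epsilon)>0$ such that, for $\mathbb P$-almost all $\omega$, the upper bounds on $|C_{f,g}(\omega,n)|$ and $|C^\Phi_{f,g}(\omega,n)|$ above can be replaced by $$c\,\|f\|_\beta\|g\|_\beta\,C(\epsilon)^{-\beta}\,e^{-(\chi^{(2)}-\epsilon)\beta n},$$ where $\chi^{(2)}\ge\ln\max(\lambda_{\mathcal C}^{-1},\lambda_{\mathcal E})$ is the almost everywhere constant, positive, Lyapunov exponent.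
   Context: Toral automorphisms. Let $\mathbb T^2=\mathbb R^2/2\pi\mathbb Z^2$ with normalized Lebesgue measure $d\mathrm m=dx/(2\pi)^2$. A toral automorphism is a map $x\mapsto Ax\pmod{2\pi}$ of $\mathbb T^2$ with $A$ a $2\times2$ integer matrix, $\det A=\pm1$; it is hyperbolic if the eigenvalues of $A$ have modulus different from $1$. Throughout, all toral automorphisms are hyperbolic with determinant $+1$. Then $A$ has an unstable eigenvalue of modulus $>1$ and a stable eigenvalue of modulus $<1$, with eigenlines $E_u^A$ and $E_s^A$. Cone property. A cone is a set in $\mathbb R^2$ spanned by two lines intersecting at the origin (a double-sided sector bounded by the two lines). A pair $(A_0,A_1)$ of hyperbolic toral automorphisms has the cone property if there exist cones $\mathcal E$ (expansion cone) and $\mathcal C$ (contraction cone) with $\mathcal E\cap\mathcal C=\{0\}$ such that for $i=0,1$: Expansion cone: (1) $A_i\mathcal E\subset\mathcal E$; (2) there is $\lambda_{\mathcal E}>1$ with $|A_ix|\ge\lambda_{\mathcal E}|x|$ for $x\in\mathcal E$; (3) $E_u^{A_i}\cap\partial\mathcal E=\{0\}$. Contraction cone: (1) $A_i^{-1}\mathcal C\subset\mathcal C$; (2) there is $0<\lambda_{\mathcal C}<1$ with $|A_i^{-1}x|\ge\lambda_{\mathcal C}^{-1}|x|$ for $x\in\mathcal C$; (3) $E_s^{A_i}\cap\partial\mathcal C=\{0\}$. Random products. Put $A_0=A$, $A_1=B$. Let $p\in(0,1)$, $\Omega=\{0,1\}^{\mathbb N}$ with elements $\omega=(\omega(0),\omega(1),\dots)$,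 shift $\tau(\omega(0),\omega(1),\dots)=(\omega(1),\omega(2),\dots)$, and let $\mathbb P$ be the product measure under which the $\omega(n)$ are independent with $\omega(n)=0$ with probability $p$ and $\omega(n)=1$ with probability $1-p$. Write $A_\omega^n=A_{\omega(n-1)}\cdots A_{\omega(0)}$. The skew product is $\Phi:\Omega\times\mathbb T^2\to\Omega\times\mathbb T^2$, $\Phi(\omega,x)=(\tau\omega,A_{\omega(0)}x)$. Lyapunov exponents. By the Multiplicative Ergodic Theorem, for $\mathbb P$-a.e. $\omega$ the limit $\Lambda_\omega=\lim_n((A_\omega^n)^TA_\omega^n)^{1/2n}$ exists; the logarithms of its eigenvalues are the Lyapunov exponents, which are $\mathbb P$-a.s. constant. Under the cone property there are two distinct ones, $\chi^{(1)}<0<\chi^{(2)}=-\chi^{(1)}$; $\chi^{(2)}$ denotes the largest (positive) one. Observables. An observable $f:\Omega\times\mathbb T^2\to\mathbb C$ satisfies the strong Hölder condition with exponent $\beta\in[0,1]$ if $$\|f\|_\beta:=\sup_{\omega\in\Omega}\sum_{q\in\mathbb Z^2}|\hat f(\omega,q)|\,|q|^\beta<\infty,$$ where $\hat f(\omega,\cdot)$ is the Fourier transform of $f(\omega,\cdot)$, so that $f(\omega,x)=\sum_{q\in\mathbb Z^2}\hat f(\omega,q)e^{iq\cdot x}$. Correlations. Writing $\mu(h)=\int h\,d\mu$, $$C_{f,g}(\omega,n)=\int_{\mathbb T^2}d\mathrm m(x)\,f(\omega,A_\omega^nx)\,g(\omega,x)-\mathrm m(f(\omega,\cdot))\,\mathrm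 m(g(\omega,\cdot)),$$ $$C^\Phi_{f,g}(\omega,n)=\int_{\mathbb T^2}d\mathrm m(x)\,(f\circ\Phi^n\cdot g)(\omega,x)-\mathrm m(f(\tau^n\omega,\cdot))\,\mathrm m(g(\omega,\cdot)).$$
   Formalization: In the almost-sure bound the constant C(ε) is allowed to depend on ω; with a constant independent of ω the claim fails, e.g. for A=[[2,1],[1,1]], B=A², since ω starts with N zeros with positive probability. *)

(* Defs.v *)
(* Mathematical Components, MathComp-Analysis and the complex numbers R[i] of
   mathcomp-real-closed.  Points of R^2 are column vectors. *)
From HB Require Import structures.
From mathcomp Require Import all_boot all_order all_algebra.
From mathcomp Require Import complex.
From mathcomp Require Import all_classical all_reals all_analysis.

Set Implicit Arguments.
Unset Strict Implicit.
Unset Printing Implicit Defensive.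

Import Order.TTheory GRing.Theory Num.Theory.
Import numFieldNormedType.Exports.
Local Open Scope classical_set_scope.
Local Open Scope ring_scope.

Section Plane.
Variable R : realType.

Definition vec2 (T : Type) (a b : T) : 'cV[T]_2 :=
  \col_i (if i == 0 then a else b).

(* The norm that the library puts on matrices is the sup norm, so the Euclidean
   norm is introduced separately; the two induce the same topology. *)
Definition enorm (x : 'cV[R]_2) : R := Num.sqrt (\sum_i x i 0 ^+ 2).

Definition real_mx m n (M : 'M[int]_(m, n)) : 'M[R]_(m, n) :=
  map_mx (intr : int -> R) M.

Definition dot (q : 'cV[int]_2) (x : 'cV[R]_2) : R :=
  \sum_i (q i 0)%:~R * x i 0.

Definition cexp (t : R) : R[i] := (cos t +i* sin t)%C.

End Plane.

Section Cones.
Variable R : realType.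

Definition hyperbolic_toral (A : 'M[int]_2) : Prop :=
  \det A = 1 /\
  forall z : R[i], eigenvalue (map_mx (intr : int -> R[i]) A) z -> `|z| != 1.

Definition unstable_line (A : 'M[R]_2) : set 'cV[R]_2 :=
  [set x | exists2 a : R, 1 < `|a| & A *m x = a *: x].

Definition stable_line (A : 'M[R]_2) : set 'cV[R]_2 :=
  [set x | exists2 a : R, `|a| < 1 & A *m x = a *: x].

(* The double-sided sector bounded by the lines R u and R v; the other sector
   bounded by the same lines is double_sector u (- v). *)
Definition double_sector (u v : 'cV[R]_2) : set 'cV[R]_2 :=
  [set x | exists s t : R, 0 <= s * t /\ x = s *: u + t *: v].

Definition is_cone (K : set 'cV[R]_2) : Prop :=
  exists u v : 'cV[R]_2, row_mx u v \in unitmx /\ K = double_sector u v.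

Definition boundary (K : set 'cV[R]_2) : set 'cV[R]_2 :=
  closure K `\` interior K.

Definition expansion_cone (A : 'M[R]_2) (lamE : R) (E : set 'cV[R]_2) : Prop :=
  [/\ forall x, E x -> E (A *m x),
      forall x, E x -> lamE * enorm x <= enorm (A *m x)
    & unstable_line A `&` boundary E = [set 0]].

Definition contraction_cone (A : 'M[R]_2) (lamC : R) (C : set 'cV[R]_2) : Prop :=
  [/\ forall x, C x -> C (invmx A *m x),
      forall x, C x -> lamC^-1 * enorm x <= enorm (invmx A *m x)
    & stable_line A `&` boundary C = [set 0]].

Definition cone_property (A0 A1 : 'M[int]_2) (lamE lamC : R) : Prop :=
  1 < lamE /\ 0 < lamC < 1 /\
  exists E C : set 'cV[R]_2,
    [/\ is_cone E, is_cone C, E `&` C = [set 0],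
        forall A, A = A0 \/ A = A1 -> expansion_cone (real_mx R A) lamE E
      & forall A, A = A0 \/ A = A1 -> contraction_cone (real_mx R A) lamC C].

End Cones.

(* The symbols 0 and 1 are encoded by false and true. *)
Definition coordinate_sets : set (set (nat -> bool)) :=
  [set S | exists n b, S = [set w | w n = b]].

Definition Omega := g_sigma_algebraType coordinate_sets.

Definition shift (w : Omega) : Omega := fun n => w n.+1.

Definition bernoulli_product (R : realType) (p : R) (P : probability Omega R) :
  Prop :=
  forall (s : seq nat) (a : nat -> bool), uniq s ->
    P [set w | forall i, i \in s -> w i = a i] =
    (\prod_(i <- s) (if a i then 1 - p else p))%:E.

Section RandomProducts.
Variables (R : realType) (A0 A1 : 'M[int]_2).

Definition gen (b : bool) : 'M[int]_2 := if b then A1 else A0.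

Fixpoint cocycle (w : Omega) (n : nat) : 'M[int]_2 :=
  if n is m.+1 then gen (w m) *m cocycle w m else 1%:M.

Definition skew (z : Omega * 'cV[R]_2) : Omega * 'cV[R]_2 :=
  (shift z.1, real_mx R (gen (z.1 0%N)) *m z.2).

(* S n is the positive semidefinite 2n-th root of (A_w^n)^T A_w^n, which is
   unique; its value at n = 0 is irrelevant. *)
Definition oseledets_limit (w : Omega) (L : 'M[R]_2) : Prop :=
  exists S : nat -> 'M[R]_2,
    (forall n, (0 < n)%N ->
       [/\ (S n)^T = S n,
           forall x : 'cV[R]_2, 0 <= (x^T *m S n *m x) 0 0
         & S n ^+ n.*2 =
           (real_mx R (cocycle w n))^T *m real_mx R (cocycle w n)]) /\
    S n @[n --> \oo] --> L.

Definition top_lyapunov_exponent (P : probability Omega R) (chi : R) : Prop :=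
  {ae P, forall w, exists L : 'M[R]_2,
     [/\ oseledets_limit w L,
         eigenvalue L (expR chi)
       & forall chi', eigenvalue L (expR chi') -> chi' <= chi]}.

End RandomProducts.

Section Observables.
Variable R : realType.
Local Notation V := 'cV[R]_2.
Local Notation mu := (@lebesgue_measure R).

Definition torus_cell : set (R * R) :=
  [set` `[0, 2 * pi[%R] `*` [set` `[0, 2 * pi[%R].

Definition torus_rmean (h : V -> R) : R :=
  (2 * pi) ^- 2 * \int[(mu \x mu)%E]_(z in torus_cell) h (vec2 z.1 z.2).

Definition torus_mean (h : V -> R[i]) : R[i] :=
  (torus_rmean (fun x => complex.Re (h x)) +i*
   torus_rmean (fun x => complex.Im (h x)))%C.

(* A function on T^2 = R^2 / 2 pi Z^2 is a 2 pi-periodic function on R^2. *)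
Definition torus_periodic (h : V -> R[i]) : Prop :=
  forall (x : V) (k : 'cV[int]_2), h (x + (2 * pi) *: real_mx R k) = h x.

Definition torus_integrable (h : V -> R[i]) : Prop :=
  (mu \x mu)%E.-integrable torus_cell
    (fun z => (complex.Re (h (vec2 z.1 z.2)))%:E) /\
  (mu \x mu)%E.-integrable torus_cell
    (fun z => (complex.Im (h (vec2 z.1 z.2)))%:E).

Implicit Types f g : Omega * V -> R[i].

Definition fourier f (w : Omega) (q : 'cV[int]_2) : R[i] :=
  torus_mean (fun x => f (w, x) * cexp (- dot q x)).

Definition fourier_partial_sum f (w : Omega) (x : V) (N : nat) : R[i] :=
  \sum_(i < N.*2.+1) \sum_(j < N.*2.+1)
    let q := vec2 (i%:Z - N%:Z) (j%:Z - N%:Z) in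
    fourier f w q * cexp (dot q x).

Definition observable f : Prop :=
  forall w, torus_periodic (fun x => f (w, x)) /\
            torus_integrable (fun x => f (w, x)).

Definition holder_norm (beta : R) f : \bar R :=
  ereal_sup [set \esum_(q in [set: 'cV[int]_2])
                   (Normc.normc (fourier f w q) * enorm (real_mx R q) `^ beta)%:E
            | w in [set: Omega]].

(* The identity f = sum_q \hat f(., q) e^{i q.x} is required at every point;
   under the finiteness of the norm the series converges absolutely, so that
   the choice of the partial sums is immaterial. *)
Definition strong_holder (beta : R) f : Prop :=
  [/\ observable f,
      (holder_norm beta f < +oo)%E
    & forall w x,
        Normc.normc (f (w, x) - fourier_partial_sum f w x N) @[N --> \oo] --> (0 : R)].

Variables A0 A1 : 'M[int]_2.

Definition corr f g (w : Omega) (n : nat) : R[i] :=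
  torus_mean (fun x => f (w, real_mx R (cocycle A0 A1 w n) *m x) * g (w, x)) -
  torus_mean (fun x => f (w, x)) * torus_mean (fun x => g (w, x)).

Definition skew_corr f g (w : Omega) (n : nat) : R[i] :=
  torus_mean (fun x => f (iter n (skew A0 A1) (w, x)) * g (w, x)) -
  torus_mean (fun x => f (iter n shift w, x)) * torus_mean (fun x => g (w, x)).

End Observables.

(* Main.v *)
Require Import Defs.
From mathcomp Require Import all_boot all_order all_algebra.
From mathcomp Require Import complex.
From mathcomp Require Import all_classical all_reals all_analysis.
From mathcomp Require Import measurable_realfun.
From mathcomp Require Import ring lra zify.
Import Order.TTheory GRing.Theory Num.Theory.
Import numFieldNormedType.Exports.
Local Open Scope classical_set_scope.
Local Open Scope ring_scope.

Set Implicit Arguments.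
Unset Strict Implicit.
Unset Printing Implicit Defensive.

(* Substituting the Fourier series of f, the correlation at time n becomes the
   sum over q <> 0 of fhat(q) ghat(- M^T q) with M = A_w^n, and is therefore at
   most |f|_beta |g|_beta sup_{q <> 0} (|q| |M^T q|)^{-beta}.  Up to a quarter
   turn, M^T q and q are the end points x_0 and x_n = M x_0 of an orbit of
   integer vectors.  In the basis spanning the expansion cone E, condition (3)
   makes all entries of the generators nonzero and of the same sign.  A vector
   of E then grows like the norm of the product applied to it, and a vector
   outside E grows like the norm of the inverse product.  Cutting the orbit where
   it enters E gives |x_0| |x_n| >= kappa |M| for a constant kappa > 0, for all
   w, n and q.  It remains to note that |M| is at least of order
   max(1/lamC, lamE)^n, and, for a typical w, of order e^{(chi - eps) n}:
   the matrices S_n of the Oseledets limit have determinant 1, so that their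
   trace s + 1/s determines the singular values s^n and s^{-n} of M. *)

(** * Products of matrices with entries of one sign *)

Section Entrywise.
Variable R : realType.
Implicit Types (M N : 'M[R]_2) (x y z : 'cV[R]_2).

Lemma sum2E (V : nmodType) (F : 'I_2 -> V) : \sum_i F i = F 0 + F 1.
Proof. by rewrite 2!big_ord_recl big_ord0 addr0; congr (_ + F _); apply/val_inj. Qed.

Lemma ord2P (i : 'I_2) : i = 0 \/ i = 1.
Proof. by case: i => -[|[|//]] ?; [left|right]; apply/val_inj. Qed.

Lemma det2E (S : comNzRingType) (M : 'M[S]_2) : \det M = M 0 0 * M 1 1 - M 0 1 * M 1 0.
Proof.
rewrite (expand_det_row _ 0) sum2E /cofactor !det_mx11 !mxE /= !expr0 expr1.
rewrite mul1r mulN1r mulrN.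
by congr (M _ _ * M _ _ - M _ _ * M _ _); apply/val_inj.
Qed.

Lemma adj2E (S : comNzRingType) (M : 'M[S]_2) :
  \adj M = \matrix_(i, j) (if i == 0 then if j == 0 then M 1 1 else - M 0 1
                           else if j == 0 then - M 1 0 else M 0 0).
Proof.
apply/matrixP => i j; rewrite !mxE /cofactor det_mx11 !mxE /=.
have e00 : lift 0 (0 : 'I_1) = 1 :> 'I_2 by apply/val_inj.
have e10 : lift 1 (0 : 'I_1) = 0 :> 'I_2 by apply/val_inj.
by case: (ord2P i) (ord2P j) => -> [] ->; rewrite /= ?e00 ?e10 ?addn0 ?add0n
  ?expr0 ?expr1 ?sqrrN ?expr1n ?mul1r ?mulN1r // -signr_odd expr0 mul1r.
Qed.

Lemma mulmx2E (S : pzSemiRingType) m n (M : 'M[S]_(m, 2)) (N : 'M[S]_(2, n)) i j :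
  (M *m N) i j = M i 0 * N 0 j + M i 1 * N 1 j.
Proof. by rewrite mxE sum2E. Qed.

(** The entrywise l1 norm: it is submultiplicative, and it can be computed exactly where no
    cancellation occurs. *)
Definition absum m n (M : 'M[R]_(m, n)) : R := \sum_i \sum_j `|M i j|.

Lemma absum_ge0 m n (M : 'M[R]_(m, n)) : 0 <= absum M.
Proof. by apply: sumr_ge0 => i _; apply: sumr_ge0. Qed.

Lemma absumM m n k (M : 'M[R]_(m, n)) (N : 'M[R]_(n, k)) :
  absum (M *m N) <= absum M * absum N.
Proof.
rewrite /absum mulr_suml; apply: ler_sum => i _.
apply: (@le_trans _ _ (\sum_j \sum_l `|M i l| * `|N l j|)).
  apply: ler_sum => j _; rewrite mxE; apply: le_trans (ler_norm_sum _ _ _) _.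
  by apply: ler_sum => l _; rewrite normrM.
rewrite exchange_big mulr_suml; apply: ler_sum => l _.
rewrite -mulr_sumr ler_wpM2l // [leRHS](bigD1 l) //= lerDl.
by apply: sumr_ge0 => ? _; apply: sumr_ge0.
Qed.

Lemma absumC_2 x : absum x = `|x 0 0| + `|x 1 0|.
Proof. by rewrite /absum sum2E !big_ord1. Qed.

Lemma absum2E M : absum M = `|M 0 0| + `|M 0 1| + (`|M 1 0| + `|M 1 1|).
Proof. by rewrite /absum !sum2E. Qed.

(** For determinant 1 the adjugate is the inverse, so a product and its inverse have the same size;
    this lets the contraction cone bound the forward product. *)
Lemma absum_adj M : absum (\adj M) = absum M.
Proof. by rewrite !absum2E adj2E !mxE /= !normrN; ring. Qed.

(** All entries are nonnegative or all are nonpositive; the pairwise form is stable under products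
    without a case distinction. *)
Definition same_sign m n (M : 'M[R]_(m, n)) := forall i j k l, 0 <= M i j * M k l.

Lemma same_signM m n k (M : 'M[R]_(m, n)) (N : 'M[R]_(n, k)) :
  same_sign M -> same_sign N -> same_sign (M *m N).
Proof.
move=> sM sN i j i' j'; rewrite !mxE mulr_suml sumr_ge0 // => l _.
rewrite mulr_sumr sumr_ge0 // => l' _.
by rewrite mulrACA mulr_ge0.
Qed.

Lemma same_sign1 n : same_sign (1%:M : 'M[R]_n).
Proof. by move=> i j k l; rewrite !mxE -natrM. Qed.

Lemma same_sign_cV x : 0 <= x 0 0 * x 1 0 -> same_sign x.
Proof.
move=> h i j k l; rewrite !ord1.
by case: (ord2P i) (ord2P k) => -> [] ->; rewrite -?expr2 ?sqr_ge0 // mulrC.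
Qed.

Lemma normrD_same_sign (a b : R) : 0 <= a * b -> `|a + b| = `|a| + `|b|.
Proof.
have [a0 | a0] := lerP 0 a; have [b0 | b0] := lerP 0 b => ab.
- by rewrite !ger0_norm ?addr_ge0.
- have -> : a = 0 by nra.
  by rewrite normr0 !add0r.
- have -> : b = 0 by nra.
  by rewrite normr0 !addr0.
- by rewrite !ltr0_norm ?opprD; lra.
Qed.

Lemma norm_addM (a b c d : R) :
  0 <= a * b -> 0 <= c * d -> `|a * c + b * d| = `|a| * `|c| + `|b| * `|d|.
Proof.
move=> ab cd; rewrite -!normrM normrD_same_sign //.
have -> : a * c * (b * d) = a * b * (c * d) by ring.
exact: mulr_ge0.
Qed.

(** No cancellation takes place, so the triangle inequality is an equality. *)
Lemma norm_mulmx_same_sign m n (M : 'M[R]_(m, 2)) (N : 'M[R]_(2, n)) i j :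
  same_sign M -> same_sign N ->
  `|(M *m N) i j| = `|M i 0| * `|N 0 j| + `|M i 1| * `|N 1 j|.
Proof. by move=> sM sN; rewrite mulmx2E norm_addM. Qed.

(** Every column and every row carries at least the fraction [r] of the total mass; for products of
    generators [r] will not depend on the length. *)
Definition balanced (r : R) M :=
  (forall j, r * absum M <= `|M 0 j| + `|M 1 j|) /\
  (forall i, r * absum M <= `|M i 0| + `|M i 1|).

(** Without cancellation, [absum (M *m y)] is the sum of the column masses of [M] weighted by the
    moduli of the coordinates of [y]. *)
Lemma absum_mulmx_ge r M y : same_sign M -> balanced r M -> 0 <= y 0 0 * y 1 0 ->
  r * absum M * absum y <= absum (M *m y).
Proof.
move=> sM [bM _] /same_sign_cV sy; rewrite !absumC_2 !norm_mulmx_same_sign //.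
have := bM 0; have := bM 1; move: (r * absum M) => s h1 h0.
have : 0 <= (`|M 0 0| + `|M 1 0| - s) * `|y 0 0| by rewrite mulr_ge0 ?subr_ge0.
have : 0 <= (`|M 0 1| + `|M 1 1| - s) * `|y 1 0| by rewrite mulr_ge0 ?subr_ge0.
by lra.
Qed.

(** When the coordinates of [M *m z] have opposite signs, the signs of [\adj M] compensate them, so
    no cancellation occurs in [z = \adj M *m (M *m z)]; the columns of [\adj M] are, up to sign and
    order, the rows of [M]. *)
Lemma absum_preimage_ge r M z : same_sign M -> balanced r M -> \det M = 1 ->
  (M *m z) 0 0 * (M *m z) 1 0 <= 0 -> r * absum M * absum (M *m z) <= absum z.
Proof.
move=> sM [_ bM] dM.
have ez : z = \adj M *m (M *m z) by rewrite mulmxA mul_adj_mx dM mul1mx.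
rewrite [X in _ <= absum X]ez; move: (M *m z) => y y0.
rewrite !absumC_2 adj2E !mulmx2E !mxE /=.
have h0 := bM 0; have h1 := bM 1; move: (r * absum M) h0 h1 => s h0 h1.
have nY : 0 <= - y 0 0 * y 1 0 by rewrite mulNr oppr_ge0.
have -> : M 1 1 * y 0 0 + - M 0 1 * y 1 0 = - (M 1 1 * (- y 0 0) + M 0 1 * y 1 0) by ring.
rewrite normrN.
have -> : - M 1 0 * y 0 0 = M 1 0 * - y 0 0 by ring.
rewrite !norm_addM // normrN.
have : 0 <= (`|M 0 0| + `|M 0 1| - s) * `|y 1 0| by rewrite mulr_ge0 ?subr_ge0.
have : 0 <= (`|M 1 0| + `|M 1 1| - s) * `|y 0 0| by rewrite mulr_ge0 ?subr_ge0.
by lra.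
Qed.

(** * Products of generators driven by a symbol sequence *)

Section Products.
Variables (G : bool -> 'M[R]_2) (r K : R).
Hypotheses (detG : forall b, \det (G b) = 1) (r_gt0 : 0 < r) (K_gt0 : 0 < K).
Hypothesis ssG : forall b, same_sign (G b).
Hypothesis leG : forall b i j, r * (2 * K) <= `|G b i j| <= K.

Fixpoint mxprod (w : nat -> bool) n : 'M[R]_2 :=
  if n is m.+1 then G (w m) *m mxprod w m else 1%:M.

Lemma mxprodD w j m :
  mxprod w (j + m) = mxprod (fun i => w (j + i)%N) m *m mxprod w j.
Proof.
by elim: m => [|m IH] /=; rewrite ?addn0 ?mul1mx // addnS /= IH mulmxA.
Qed.

Lemma mxprodSr w n : mxprod w n.+1 = mxprod (fun i => w i.+1) n *m G (w 0%N).
Proof. by have := mxprodD w 1 n; rewrite /= mulmx1. Qed.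

Lemma det_mxprod w n : \det (mxprod w n) = 1.
Proof. by elim: n => [|n IH] /=; rewrite ?det1 // det_mulmx detG IH mul1r. Qed.

Lemma same_sign_mxprod w n : same_sign (mxprod w n).
Proof.
by elim: n => [|n IH] /=; [exact: same_sign1 | exact: same_signM].
Qed.

Lemma absum_factor b : absum (G b) <= 4 * K.
Proof.
rewrite absum2E.
case/andP: (leG b 0 0); case/andP: (leG b 0 1).
by case/andP: (leG b 1 0); case/andP: (leG b 1 1); lra.
Qed.

Lemma balanced1 : balanced r 1%:M.
Proof.
(* The entry bounds give [r * (2 * K) <= K]; each row and column of the identity has half of its
   mass. *)
have r2 : r * 2 <= 1.
  rewrite -(ler_pM2r K_gt0) mul1r -mulrA.
  by have /andP[h1 h2] := leG true 0 0; exact: le_trans h1 h2.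
split=> i; case: (ord2P i) => ->;
  by rewrite absum2E !mxE /= ?normr0 ?normr1; lra.
Qed.

(** The row masses of a product are controlled by its leftmost factor and the column masses by its
    rightmost one. Since [2 * K] bounds the row and column masses of a generator, entries of size at
    least [r * (2 * K)] give the ratio [r] for every length. *)
Lemma balanced_mxprod w n : balanced r (mxprod w n).
Proof.
split=> i; last first.
  case: n => [|n]; first exact: (balanced1.2 i).
  rewrite /=; set M := mxprod w n; set g := G _.
  have sM : same_sign M := same_sign_mxprod _ _; have sg : same_sign g := ssG _.
  rewrite absum2E !norm_mulmx_same_sign //.
  have := normr_ge0 (M 0 0); have := normr_ge0 (M 0 1).
  have := normr_ge0 (M 1 0); have := normr_ge0 (M 1 1).
  move: `|M 0 0| `|M 0 1| `|M 1 0| `|M 1 1| => a b c d d0 c0 b0 a0.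
  case/andP: (leG (w n) i 0) => h1 _; case/andP: (leG (w n) i 1) => h2 _.
  case/andP: (leG (w n) 0 0) => _ k1; case/andP: (leG (w n) 0 1) => _ k2.
  case/andP: (leG (w n) 1 0) => _ k3; case/andP: (leG (w n) 1 1) => _ k4.
  apply: (@le_trans _ _ (r * (2 * K) * (a + b + c + d))).
    rewrite -mulrA ler_wpM2l ?(ltW r_gt0) //.
    have := ler_wpM2r (addr_ge0 a0 b0) k1; have := ler_wpM2r (addr_ge0 a0 b0) k3.
    have := ler_wpM2r (addr_ge0 c0 d0) k2; have := ler_wpM2r (addr_ge0 c0 d0) k4.
    by rewrite -/g; lra.
  have := ler_wpM2r (addr_ge0 a0 b0) h1; have := ler_wpM2r (addr_ge0 c0 d0) h2.
  by rewrite -/g; lra.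
case: n => [|n]; first exact: (balanced1.1 i).
rewrite mxprodSr; set M := mxprod _ n; set g := G _.
have sM : same_sign M := same_sign_mxprod _ _; have sg : same_sign g := ssG _.
rewrite absum2E !norm_mulmx_same_sign //.
have := normr_ge0 (M 0 0); have := normr_ge0 (M 0 1).
have := normr_ge0 (M 1 0); have := normr_ge0 (M 1 1).
move: `|M 0 0| `|M 0 1| `|M 1 0| `|M 1 1| => a b c d d0 c0 b0 a0.
case/andP: (leG (w 0%N) 0 i) => h1 _; case/andP: (leG (w 0%N) 1 i) => h2 _.
case/andP: (leG (w 0%N) 0 0) => _ k1; case/andP: (leG (w 0%N) 0 1) => _ k2.
case/andP: (leG (w 0%N) 1 0) => _ k3; case/andP: (leG (w 0%N) 1 1) => _ k4.
apply: (@le_trans _ _ (r * (2 * K) * (a + b + c + d))).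
  rewrite -mulrA ler_wpM2l ?(ltW r_gt0) //.
  have := ler_wpM2l (addr_ge0 a0 c0) k1; have := ler_wpM2l (addr_ge0 a0 c0) k2.
  have := ler_wpM2l (addr_ge0 b0 d0) k3; have := ler_wpM2l (addr_ge0 b0 d0) k4.
  by rewrite -/g; lra.
have := ler_wpM2l (addr_ge0 a0 c0) h1; have := ler_wpM2l (addr_ge0 b0 d0) h2.
by rewrite -/g; lra.
Qed.

(* If the orbit enters the cone of vectors with coordinates of equal sign, it
   stays there and grows like the remaining product; before the entrance,
   it shrinks at the rate of the elapsed product. *)
Lemma mxprod_orbit_ge eta w n z : 0 < eta ->
  (forall k, (k <= n)%N -> eta <= absum (mxprod w k *m z)) ->
  r ^+ 2 * eta ^+ 2 / (4 * K + 1) * absum (mxprod w n) <=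
    absum z * absum (mxprod w n *m z).
Proof.
move=> eta_gt0 far.
have K4 : 0 < 4 * K + 1 by rewrite addr_gt0 ?mulr_gt0 ?ltr0n.
have r2 : r * 2 <= 1.
  rewrite -(ler_pM2r K_gt0) mul1r -mulrA.
  by have /andP[h1 h2] := leG true 0 0; exact: le_trans h1 h2.
have N0 := absum_ge0 (mxprod w n).
(* Covers an orbit lying wholly inside the cone or wholly outside it, where a single growth estimate
   holds; the extra factor [r] and the divisor [4 * K + 1] are harmless since [r <= 1/2] and
   [K > 0]. *)
have simple a b : eta <= a -> r * absum (mxprod w n) * a <= b ->
    r ^+ 2 * eta ^+ 2 / (4 * K + 1) * absum (mxprod w n) <= b * a.
  move=> ea h; rewrite mulrAC ler_pdivrMr //.
  have h1 : r * absum (mxprod w n) * eta * eta <= b * a.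
    apply: ler_pM => //; rewrite ?mulr_ge0 ?(ltW r_gt0) ?(ltW eta_gt0) //.
    apply: le_trans h; rewrite ler_wpM2l ?mulr_ge0 ?(ltW r_gt0) //.
  have h0 : 0 <= r * absum (mxprod w n) * eta * eta.
    by rewrite !mulr_ge0 ?(ltW r_gt0) ?(ltW eta_gt0).
  have : r * (r * absum (mxprod w n) * eta * eta) <= r * absum (mxprod w n) * eta * eta.
    by rewrite ler_piMl //; lra.
  have : 0 <= 4 * K * (b * a) by rewrite mulr_ge0 ?(le_trans h0 h1) ?mulr_ge0 ?(ltW K_gt0).
  rewrite !expr2; lra.
pose E k := 0 <= (mxprod w k *m z) 0 0 * (mxprod w k *m z) 1 0.
have [/existsP[[a /= an] Ea] | noE] := boolP [exists k : 'I_n.+1, E k]; last first.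
  apply: simple; first exact: far.
  apply: absum_preimage_ge; [exact: same_sign_mxprod | exact: balanced_mxprod | exact: det_mxprod |].
  move: noE; rewrite negb_exists => /forallP/(_ ord_max) /=.
  by rewrite /E -ltNge => /ltW.
(* The first entrance time; minimality puts the preceding orbit point, if any, outside the cone. *)
case: (ex_minnP (ex_intro E a Ea)) => b Eb bmin.
have bn : (b <= n)%N by rewrite (leq_trans (bmin _ Ea)).
case: b bn bmin Eb => [_ _ E0 | {an Ea}{}a an amin Ea].
  rewrite [leRHS]mulrC; apply: simple; first by have := far 0%N (leq0n _); rewrite mul1mx.
  apply: absum_mulmx_ge; [exact: same_sign_mxprod | exact: balanced_mxprod |].
  by move: E0; rewrite /E /= mul1mx.
pose Q := mxprod (fun i => w (a.+1 + i)%N) (n - a.+1).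
have dn : mxprod w n = Q *m mxprod w a.+1 by rewrite -mxprodD subnKC.
have step1 : r * absum (mxprod w a) * absum (mxprod w a *m z) <= absum z.
  apply: absum_preimage_ge; [exact: same_sign_mxprod | exact: balanced_mxprod | exact: det_mxprod |].
  by rewrite leNgt; apply/negP => /ltW /amin; rewrite ltnn.
have step2 : r * absum Q * absum (mxprod w a.+1 *m z) <= absum (mxprod w n *m z).
  have -> : mxprod w n *m z = Q *m (mxprod w a.+1 *m z) by rewrite dn (mulmxA Q (mxprod w a.+1) z).
  apply: absum_mulmx_ge;
    [exact: same_sign_mxprod | exact: balanced_mxprod | exact: Ea].
have N1 := absum_ge0 (mxprod w a); have N2 := absum_ge0 Q.
(* The factor [G (w a)], at the moment of entrance, is covered by neither estimate and costs at most
   [4 * K]. *)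
have step3 : absum (mxprod w n) <= absum Q * (4 * K * absum (mxprod w a)).
  rewrite dn; apply: le_trans (absumM _ _) _; rewrite ler_wpM2l //.
  apply: le_trans (absumM _ _) _; rewrite ler_wpM2r //.
  exact: absum_factor.
have e1 := far a (ltnW an); have e2 := far a.+1 an.
have := @ler_pM _ (r * absum (mxprod w a) * eta) (absum z) (r * absum Q * eta) _
  ltac:(by rewrite !mulr_ge0 ?(ltW r_gt0) ?(ltW eta_gt0))
  ltac:(by rewrite !mulr_ge0 ?(ltW r_gt0) ?(ltW eta_gt0))
  (le_trans (ler_wpM2l (mulr_ge0 (ltW r_gt0) N1) e1) step1)
  (le_trans (ler_wpM2l (mulr_ge0 (ltW r_gt0) N2) e2) step2).
move=> h; rewrite mulrAC ler_pdivrMr //.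
have t0 : 0 <= r ^+ 2 * eta ^+ 2 by rewrite mulr_ge0 ?sqr_ge0.
apply: le_trans (ler_wpM2l t0 step3) _.
have h' := ler_wpM2r (ltW K4) h.
apply: le_trans h'.
have q0 : 0 <= r ^+ 2 * eta ^+ 2 * (absum Q * absum (mxprod w a)) by rewrite mulr_ge0 // mulr_ge0.
rewrite !expr2 in q0 *; lra.
Qed.

End Products.
End Entrywise.

(** * Cones *)

Section Quadrant.
Variable R : realType.
Implicit Types (M N : 'M[R]_2) (u v x y z : 'cV[R]_2).

Lemma enorm_ge0 x : 0 <= enorm x. Proof. exact: sqrtr_ge0. Qed.

Lemma sqr_enorm x : enorm x ^+ 2 = x 0 0 ^+ 2 + x 1 0 ^+ 2.
Proof. by rewrite /enorm sum2E sqr_sqrtr // addr_ge0 ?sqr_ge0. Qed.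

Lemma enorm_le_absum x : enorm x <= absum x.
Proof.
rewrite -(@ler_pXn2r _ 2) ?nnegrE ?enorm_ge0 ?absum_ge0 // sqr_enorm absumC_2.
rewrite sqrrD !real_normK ?num_real //.
by have := mulr_ge0 (normr_ge0 (x 0 0)) (normr_ge0 (x 1 0)); lra.
Qed.

Lemma absum_le_enorm x : absum x <= 2 * enorm x.
Proof.
have h i : `|x i 0| <= enorm x.
  rewrite -(@ler_pXn2r _ 2) ?nnegrE ?enorm_ge0 // sqr_enorm real_normK ?num_real //.
  by case: (ord2P i) => ->; rewrite ?lerDl ?lerDr sqr_ge0.
by rewrite absumC_2 mulr2n mulrDl mul1r lerD.
Qed.

Lemma enorm_gt0 x : x != 0 -> 0 < enorm x.
Proof.
move=> x0; rewrite lt_neqAle enorm_ge0 andbT eq_sym; apply: contra x0 => /eqP e.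
have := sqr_enorm x; rewrite e expr0n /= => /esym/eqP.
rewrite paddr_eq0 ?sqr_ge0 // !sqrf_eq0 => /andP[/eqP h0 /eqP h1].
by apply/eqP/matrixP => i j; rewrite ord1 mxE; case: (ord2P i) => ->.
Qed.

Lemma enormZ (a : R) x : enorm (a *: x) = `|a| * enorm x.
Proof.
apply/eqP; rewrite -(@eqrXn2 _ 2) ?mulr_ge0 ?enorm_ge0 //.
by rewrite exprMn !sqr_enorm !mxE real_normK ?num_real // !exprMn mulrDr.
Qed.

Lemma enorm_int_ge1 (q : 'cV[int]_2) : q != 0 -> 1 <= enorm (real_mx R q).
Proof.
move=> q0; rewrite -(@ler_pXn2r _ 2) ?nnegrE ?enorm_ge0 // sqr_enorm !mxE expr1n.
rewrite -!rmorphXn -rmorphD /= (_ : 1 = 1%:~R) // ler_int.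
rewrite -gtz0_ge1 lt_neqAle addr_ge0 ?sqr_ge0 // andbT eq_sym.
apply: contra q0; rewrite paddr_eq0 ?sqr_ge0 // !sqrf_eq0 => /andP[/eqP h0 /eqP h1].
by apply/eqP/matrixP => i j; rewrite ord1 mxE; case: (ord2P i) => ->.
Qed.

Lemma mulmx_row_mx2 (u v y : 'cV[R]_2) :
  row_mx u v *m y = y 0 0 *: u + y 1 0 *: v.
Proof.
apply/matrixP => i j; rewrite ord1 mulmx2E !mxE.
have -> : (0 : 'I_2) = lshift 1 (0 : 'I_1) by apply/val_inj.
have -> : (1 : 'I_2) = rshift 1 (0 : 'I_1) by apply/val_inj.
by rewrite (unsplitK (inl _)) (unsplitK (inr _)) mulrC [X in _ + X]mulrC.
Qed.

(** In the basis [u], [v] the sector is the union of the closed first and third quadrants. *)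
Lemma double_sectorE u v y : row_mx u v \in unitmx ->
  double_sector u v (row_mx u v *m y) <-> 0 <= y 0 0 * y 1 0.
Proof.
move=> uT; split=> [[s [t [st e]]] | y0]; last first.
  by exists (y 0 0), (y 1 0); rewrite mulmx_row_mx2.
suff -> : y = vec2 s t by rewrite !mxE.
apply: (can_inj (mulKmx uT)); rewrite e mulmx_row_mx2.
by rewrite !mxE.
Qed.

Lemma double_sectorC u v : double_sector u v = double_sector v u.
Proof.
by apply/seteqP; split=> x [s [t [st ->]]]; exists t, s; rewrite mulrC addrC.
Qed.

Lemma row_mxC_unit u v : row_mx u v \in unitmx -> row_mx v u \in unitmx.
Proof.
rewrite !unitmxE !unitfE !det2E.
have h (a b : 'cV[R]_2) i : row_mx a b i (0 : 'I_2) = a i 0 /\ row_mx a b i (1 : 'I_2) = b i 0.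
  have -> : (0 : 'I_2) = lshift 1 (0 : 'I_1) by apply/val_inj.
  have -> : (1 : 'I_2) = rshift 1 (0 : 'I_1) by apply/val_inj.
  by rewrite row_mxEl row_mxEr.
rewrite !(h _ _ _).1 !(h _ _ _).2; apply: contra => /eqP e; apply/eqP; lra.
Qed.

(** The points [u - e *: v] with [e > 0] lie outside the sector and tend to [u]. *)
Lemma edge_boundary u v : row_mx u v \in unitmx -> boundary (double_sector u v) u.
Proof.
move=> uT; split.
  by apply: subset_closure; exists 1, 0; rewrite mulr0 scale1r scale0r addr0.
rewrite /interior /= => uE.
have cv : (fun e : R => u - e *: v) e @[e --> 0^'+] --> u.
  have -> : nbhs u = nbhs (u - 0 *: v) by rewrite scale0r subr0.
  apply: cvgB; first exact: cvg_cst.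
  by apply: cvgZr_tmp; apply: cvg_at_right_filter; exact: cvg_id.
have : \forall e \near (0 : R)^'+, double_sector u v (u - e *: v) by exact: cv uE.
move=> hE.
have [e [e0 /= he]] : exists e : R, 0 < e /\ double_sector u v (u - e *: v).
  have : \forall e \near (0 : R)^'+, 0 < e /\ double_sector u v (u - e *: v).
    near=> e; split; first by near: e; exact: nbhs_right_gt.
    by near: e.
  by move/filter_ex.
have : double_sector u v (row_mx u v *m vec2 1 (- e)).
  by rewrite mulmx_row_mx2 !mxE /= scale1r scaleNr.
by move/(double_sectorE _ uT); rewrite !mxE /= mul1r oppr_ge0 leNgt e0.
Unshelve. all: by end_near.
Qed.

(* Put [p = M 0 1 * M 1 0].  Invariance of the edges and [det M = 1] give
   [p * (1 + p) >= 0]; for [p <= -1] the form [(M y)_0 (M y)_1] is negative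
   somewhere on the quadrant, so [p > 0] and all entries have the same sign. *)
Lemma invariant_quadrant M : \det M = 1 ->
  (forall y : 'cV[R]_2, 0 <= y 0 0 * y 1 0 -> 0 <= (M *m y) 0 0 * (M *m y) 1 0) ->
  M 1 0 != 0 -> M 0 1 != 0 -> same_sign M /\ forall i j, M i j != 0.
Proof.
rewrite det2E => dM inv.
have q a b : 0 <= a * b ->
    0 <= (M 0 0 * a + M 0 1 * b) * (M 1 0 * a + M 1 1 * b).
  by have := inv (vec2 a b); rewrite !mulmx2E !mxE.
have E i j : M i j = if i == 0 then if j == 0 then M 0 0 else M 0 1
             else if j == 0 then M 1 0 else M 1 1.
  by case: (ord2P i) (ord2P j) => -> [] ->.
move: E dM q; move: (M 0 0) (M 0 1) (M 1 0) (M 1 1) => a b c d E dM q c0 b0.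
have ac : 0 <= a * c by have := q 1 0; rewrite !mulr1 !mulr0 !addr0; exact.
have bd : 0 <= b * d by have := q 0 1; rewrite !mulr1 !mulr0 !add0r; exact.
have bc : 0 < b * c.
  rewrite lt_neqAle eq_sym mulf_neq0 //= leNgt; apply/negP => bc.
  have bc1 : b * c <= -1 by nra.
  have [/eqP a0c | ac0] := eqVneq (a * c) 0.
    (* With [a * c = 0] the form is [(1 + 2 * (b * c)) * x * y + b * d * y ^+ 2], where
       [1 + 2 * (b * c) <= -1]; at this point it is at most [-1]. *)
    have := q (b * d + 1) 1; rewrite mulr1 => /(_ ltac:(by rewrite addr_ge0)).
    have : (a * (b * d + 1) + b * 1) * (c * (b * d + 1) + d * 1) =
      a * c * (b * d + 1) ^+ 2 + b * d + (1 + 2 * (b * c)) * (b * d + 1).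
      by have : a * d = 1 + b * c; [lra | move=> /eqP/eqP e; ring: e].
    by rewrite (eqP a0c); nra.
  (* The minimum in the first coordinate for a fixed second one; the discriminant of the form is 1,
     so the value is [- (a * c)]. *)
  have := q (- (1 + 2 * (b * c))) (2 * (a * c)).
  have : (a * - (1 + 2 * (b * c)) + b * (2 * (a * c))) *
         (c * - (1 + 2 * (b * c)) + d * (2 * (a * c))) = - (a * c).
    have e : a * d = 1 + b * c by lra.
    by ring: e.
  move=> -> h; have := h ltac:(by nra).
  by rewrite oppr_ge0 => h'; move/eqP: ac0; apply; apply/le_anti; rewrite h' ac.
have a0 : a != 0 by apply: contraTneq bc => a0; rewrite -leNgt; nra.
have d0 : d != 0 by apply: contraTneq bc => d0; rewrite -leNgt; nra.
have h : 0 < a * c by rewrite lt_neqAle eq_sym mulf_neq0.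
have h' : 0 < b * d by rewrite lt_neqAle eq_sym mulf_neq0.
split=> [i j k l | i j]; last first.
  by rewrite E; case: (ord2P i) (ord2P j) => -> [] ->.
have bc' := ltW bc.
have ab : 0 <= a * b by nra.
have ad : 0 <= a * d by nra.
have cd : 0 <= c * d by nra.
rewrite (E i j) (E k l).
by case: (ord2P i) (ord2P j) (ord2P k) (ord2P l) => -> [] -> [] -> [] ->;
  rewrite /= -?expr2 ?sqr_ge0 //; rewrite mulrC.
Qed.
End Quadrant.

Section Cones.
Variable R : realType.
Implicit Types (M N : 'M[R]_2) (u v x y z : 'cV[R]_2).

Lemma real_mxM m n k (X : 'M[int]_(m, n)) (Y : 'M[int]_(n, k)) :
  real_mx R (X *m Y) = real_mx R X *m real_mx R Y.
Proof. exact: map_mxM. Qed.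

Lemma det_real_mx n (X : 'M[int]_n) : \det X = 1 -> \det (real_mx R X) = 1.
Proof. by rewrite /real_mx det_map_mx => ->. Qed.

Lemma det_gen (A B : 'M[int]_2) b : \det A = 1 -> \det B = 1 -> \det (gen A B b) = 1.
Proof. by case: b. Qed.

Lemma det_cocycle (A B : 'M[int]_2) w n : \det A = 1 -> \det B = 1 ->
  \det (cocycle A B w n) = 1.
Proof.
by move=> dA dB; elim: n => [|n IH] /=; rewrite ?det1 // det_mulmx IH det_gen.
Qed.

Lemma unitmx_det1 n (X : 'M[R]_n) : \det X = 1 -> X \in unitmx.
Proof. by rewrite unitmxE => ->; rewrite unitr1. Qed.

Lemma invmx_det1 n (X : 'M[R]_n) : \det X = 1 -> invmx X = \adj X.
Proof. by move=> d; rewrite /invmx unitmx_det1 // d invr1 scale1r. Qed.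

(** * An expansion cone in the coordinates of its edges *)

Section ExpansionCone.
Variables (M : 'M[R]_2) (lam : R) (u v : 'cV[R]_2).
Hypotheses (detM : \det M = 1) (lam_gt1 : 1 < lam) (uT : row_mx u v \in unitmx).
Hypothesis exM : expansion_cone M lam (double_sector u v).

(** An eigenvector in the cone has an eigenvalue of modulus at least [lam], hence lies on the
    unstable line, which meets the boundary only at 0. *)
Lemma expansion_edge_not_eigen x a : boundary (double_sector u v) x ->
  double_sector u v x -> x != 0 -> M *m x != a *: x.
Proof.
case: exM => _ ex un bx Ex x0; apply/eqP => e; have := ex _ Ex.
rewrite e enormZ ler_pM2r ?enorm_gt0 // => la.
have : (unstable_line M `&` boundary (double_sector u v)) x.
  by split=> //; exists a => //; exact: lt_le_trans la.
by rewrite un /= => h; move/eqP: x0.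
Qed.

Lemma row_mx_unit_neq0 : u != 0 /\ v != 0.
Proof.
have h y : y != 0 -> y 0 0 *: u + y 1 0 *: v != 0.
  rewrite -mulmx_row_mx2; apply: contra => /eqP e.
  by rewrite -[y](mulKmx uT) e mulmx0.
split.
- have := h (vec2 1 0); rewrite !mxE /= scale1r scale0r addr0; apply.
  by apply/eqP => /matrixP/(_ 0 0)/eqP; rewrite !mxE /= oner_eq0.
- have := h (vec2 0 1); rewrite !mxE /= scale1r scale0r add0r; apply.
  by apply/eqP => /matrixP/(_ 1 0)/eqP; rewrite !mxE /= oner_eq0.
Qed.

(** The columns of [G] are the images of the edges in the basis of the edges; a zero off-diagonal
    entry would make [u] or [v] an eigenvector. *)
Lemma expansion_cone_coord :
  let G := invmx (row_mx u v) *m M *m row_mx u v in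
  same_sign G /\ forall i j, G i j != 0.
Proof.
set T := row_mx u v => G.
have TG y : T *m (G *m y) = M *m (T *m y) by rewrite /G !mulmxA mulmxV // mul1mx.
have [u0 v0] := row_mx_unit_neq0.
have col0 a b : G *m vec2 a b = vec2 (G 0 0 * a + G 0 1 * b) (G 1 0 * a + G 1 1 * b).
  apply/matrixP => i j; rewrite ord1 mulmx2E !mxE /=.
  by case: (ord2P i) => ->.
apply: invariant_quadrant.
- by rewrite !det_mulmx detM mulr1 -det_mulmx mulVmx // det1.
- move=> y /(double_sectorE _ uT) Ey; apply/(double_sectorE _ uT).
  by rewrite -/T TG; case: exM => inv _ _; exact: inv.
- apply/eqP => g0.
  have := TG (vec2 1 0); rewrite col0 g0 !mulmx_row_mx2 !mxE /=.
  rewrite !(mulr0, mul0r, mulr1, addr0, add0r, scale0r, scale1r).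
  move/esym/eqP; apply/negP; apply: expansion_edge_not_eigen => //.
    exact: edge_boundary.
  by exists 1, 0; rewrite mulr0 scale1r scale0r addr0.
- apply/eqP => g0.
  have := TG (vec2 0 1); rewrite col0 g0 !mulmx_row_mx2 !mxE /=.
  rewrite !(mulr0, mul0r, mulr1, addr0, add0r, scale0r, scale1r).
  move/esym/eqP; apply/negP; apply: expansion_edge_not_eigen => //.
    by rewrite double_sectorC; apply: edge_boundary; exact: row_mxC_unit.
  by exists 0, 1; rewrite mul0r scale1r scale0r add0r.
Qed.

End ExpansionCone.

Lemma finite_pos_lower_bound (I : finType) (f : I -> R) :
  (forall i, 0 < f i) -> exists2 m, 0 < m & forall i, m <= f i.
Proof.
move=> f0; exists (\big[Num.min/1]_i f i); first exact: lt_bigmin.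
by move=> i; exact: bigmin_le.
Qed.

(* Nonzero integer vectors have length at least 1, so no orbit point is short
   at the time when the orbit enters the expansion cone. *)
Lemma cone_orbit_ge (A B : 'M[int]_2) (lamE lamC : R) : \det A = 1 -> \det B = 1 ->
  cone_property A B lamE lamC ->
  exists2 kappa : R, 0 < kappa &
    forall w n (q : 'cV[int]_2), q != 0 ->
      kappa * absum (real_mx R (cocycle A B w n)) <=
        enorm (real_mx R q) * enorm (real_mx R (cocycle A B w n *m q)).
Proof.
move=> dA dB [lE [_ [E [_ [[u [v [uT ->]]] _ _ ex _]]]]].
set T := row_mx u v in uT.
pose G b := invmx T *m real_mx R (gen A B b) *m T.
have dgen b : \det (real_mx R (gen A B b)) = 1 by apply: det_real_mx; exact: det_gen.
have hG b : same_sign (G b) /\ forall i j, G b i j != 0.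
  apply: (@expansion_cone_coord (real_mx R (gen A B b)) lamE) => //.
  by apply: ex; case: b; [right | left].
have dG b : \det (G b) = 1.
  by rewrite !det_mulmx dgen mulr1 -det_mulmx mulVmx // det1.
have [m m0 hm] := @finite_pos_lower_bound (bool * 'I_2 * 'I_2)%type
  (fun t => `|G t.1.1 t.1.2 t.2|) ltac:(by move=> t; rewrite normr_gt0 (hG _).2).
(* [m] and [K] bound the entries of both generators from below and above; [r] is then the largest
   ratio with [r * (2 * K) <= m]. *)
pose K := \sum_b absum (G b).
have leK b i j : `|G b i j| <= K.
  rewrite /K (bigD1 b) //= /absum (bigD1 i) //= (bigD1 j) //= -!addrA lerDl.
  by rewrite !addr_ge0 ?sumr_ge0 // => *; rewrite ?absum_ge0 ?sumr_ge0.
have K0 : 0 < K by apply: lt_le_trans (leK true 0 0); rewrite normr_gt0 (hG _).2.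
pose r := m / (2 * K).
have r0 : 0 < r by rewrite divr_gt0 ?mulr_gt0.
have leG b i j : r * (2 * K) <= `|G b i j| <= K.
  by rewrite leK andbT /r divfK ?(hm (b, i, j)) // lt0r_neq0 // mulr_gt0.
have cG w n : mxprod G w n = invmx T *m real_mx R (cocycle A B w n) *m T.
  elim: n => [|n IH] /=.
    by rewrite /real_mx map_mx1 mulmx1 mulVmx.
  by rewrite IH real_mxM /G !mulmxA mulmxK.
pose t := absum T; pose t' := absum (invmx T).
have tt' : 0 < t * t'.
  apply: (@lt_le_trans _ _ (absum (1%:M : 'M[R]_2))).
    by rewrite absum2E !mxE /= normr1 normr0 addr0 add0r addr_gt0.
  by rewrite -(mulmxV uT) absumM.
have t0 : 0 < t.
  by rewrite lt_neqAle absum_ge0 andbT eq_sym; apply: contraTneq tt' => ->; rewrite mul0r ltxx.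
have t'0 : 0 < t' by rewrite -(pmulr_rgt0 _ t0).
(* The constant of the orbit estimate for [eta = t^-1]: a nonzero integer vector has length at least
   1, hence coordinates in the new basis of total size at least [t^-1]. *)
pose k0 := r ^+ 2 * t^-1 ^+ 2 / (4 * K + 1).
have k00 : 0 < k0.
  by apply: divr_gt0; [rewrite mulr_gt0 ?exprn_gt0 ?invr_gt0 | rewrite addr_gt0 ?mulr_gt0].
(* Undoing the change of basis costs [t * t'] for the product and [2 * t'] for each endpoint. *)
exists (k0 / (4 * t' ^+ 2 * (t * t'))).
  by rewrite divr_gt0 // !mulr_gt0 // exprn_gt0.
move=> w n q q0.
pose z := invmx T *m real_mx R q.
have Pz k : mxprod G w k *m z = invmx T *m real_mx R (cocycle A B w k *m q).
  by rewrite cG /z real_mxM !mulmxA mulmxK.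
have cq0 k : cocycle A B w k *m q != 0.
  apply: contra q0 => /eqP e.
  have uc : cocycle A B w k \in unitmx by rewrite unitmxE det_cocycle // unitr1.
  by rewrite -[q](mulKmx uc) e mulmx0.
have far k : (k <= n)%N -> t^-1 <= absum (mxprod G w k *m z).
  move=> _; rewrite Pz -div1r ler_pdivrMr //.
  apply: le_trans (enorm_int_ge1 R (cq0 k)) _; apply: le_trans (enorm_le_absum _) _.
  rewrite -{1}[real_mx R _](mulKVmx uT) mulrC; exact: absumM.
have {}far : k0 * absum (mxprod G w n) <= absum z * absum (mxprod G w n *m z).
  by apply: mxprod_orbit_ge => // [b|]; rewrite ?invr_gt0 //; exact: (hG b).1.
rewrite mulrAC ler_pdivrMr ?mulr_gt0 ?exprn_gt0 //.
have h1 : absum (real_mx R (cocycle A B w n)) <= t * t' * absum (mxprod G w n).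
  have -> : real_mx R (cocycle A B w n) = T *m mxprod G w n *m invmx T.
    by rewrite cG !mulmxA mulmxV // mul1mx mulmxK.
  apply: le_trans (absumM _ _) _; rewrite mulrAC ler_wpM2r ?absum_ge0 //.
  exact: absumM.
have bnd x : absum (invmx T *m x) <= 2 * t' * enorm x.
  apply: le_trans (absumM _ _) _; rewrite -/t' [2 * _]mulrC -mulrA.
  by rewrite ler_wpM2l ?(ltW t'0) // absum_le_enorm.
have h2 : absum z * absum (mxprod G w n *m z) <=
   2 * t' * enorm (real_mx R q) * (2 * t' * enorm (real_mx R (cocycle A B w n *m q))).
  by rewrite Pz ler_pM ?absum_ge0 ?bnd.
apply: le_trans (ler_wpM2l (ltW k00) h1) _.
rewrite mulrCA; apply: le_trans (ler_wpM2l (ltW tt') (le_trans far h2)) _.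
by rewrite le_eqVlt; apply/orP; left; apply/eqP; ring.
Qed.

(** * From orbits in the plane to frequencies *)

Definition rot (S : zmodType) (q : 'cV[S]_2) : 'cV[S]_2 := vec2 (- q 1 0) (q 0 0).

(* Since [det X = 1], the quarter turn conjugates the transpose, which acts on
   frequencies, into the inverse, which acts on the plane. *)
Lemma mulmx_rot_tr (X : 'M[int]_2) q : \det X = 1 -> X *m rot (X^T *m q) = rot q.
Proof.
rewrite det2E => dX; apply/matrixP => i j.
rewrite ord1 mulmx2E !mxE !sum2E !mxE /=.
case: (ord2P i) => ->; rewrite /=.
  by rewrite -[in RHS](mul1r (q 1 0)) -dX; ring.
by rewrite -[in RHS](mul1r (q 0 0)) -dX; ring.
Qed.

Lemma enorm_rot q : enorm (real_mx R (rot q)) = enorm (real_mx R q).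
Proof.
apply/eqP; rewrite -(@eqrXn2 _ 2) ?enorm_ge0 // !sqr_enorm !mxE /= rmorphN sqrrN.
by rewrite addrC.
Qed.

Lemma rot_eq0 (q : 'cV[int]_2) : (rot q == 0) = (q == 0).
Proof.
apply/eqP/eqP => [/matrixP h | ->]; apply/matrixP => i j; rewrite ord1 !mxE.
  have := h 0 0; have := h 1 0; rewrite !mxE /= => h0 /eqP; rewrite oppr_eq0 => /eqP h1.
  by case: (ord2P i) => ->.
by rewrite oppr0 if_same.
Qed.

(** With [M] the cocycle, the orbit estimate is applied from [rot (M^T *m q)] to [rot q]; the
    quarter turn preserves integrality and lengths. *)
Lemma cone_dual_orbit_ge (A B : 'M[int]_2) (lamE lamC : R) : \det A = 1 -> \det B = 1 ->
  cone_property A B lamE lamC ->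
  exists2 kappa : R, 0 < kappa &
    forall w n (q : 'cV[int]_2), q != 0 ->
      kappa * absum (real_mx R (cocycle A B w n)) <=
        enorm (real_mx R q) * enorm (real_mx R ((cocycle A B w n)^T *m q)).
Proof.
move=> dA dB /(cone_orbit_ge dA dB)[k k0 hk]; exists k => // w n q q0.
have e := mulmx_rot_tr q (det_cocycle w n dA dB).
have r0 : rot ((cocycle A B w n)^T *m q) != 0.
  apply: contra q0 => /eqP r0; move: e; rewrite r0 mulmx0 => /esym/eqP.
  by rewrite rot_eq0.
have := hk w n _ r0; rewrite e !enorm_rot => /le_trans; apply.
by rewrite mulrC.
Qed.

(** An edge of the expansion cone is stretched at least by [lamE ^+ n] under the product, and one of
    the contraction cone at least by [lamC^-1 ^+ n] under the inverse, which has the same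
    [absum]. *)
Lemma absum_cocycle_ge (A B : 'M[int]_2) (lamE lamC : R) w n : \det A = 1 -> \det B = 1 ->
  cone_property A B lamE lamC ->
  Num.max lamC^-1 lamE ^+ n <= 2 * absum (real_mx R (cocycle A B w n)).
Proof.
move=> dA dB [lE [/andP[lC0 lC1] [E [C [[u [v [uT ->]]] [u' [v' [uT' ->]]] _ exE exC]]]]].
have dM := det_real_mx (det_cocycle w n dA dB).
set M := real_mx R (cocycle A B w n) in dM *.
have edge (a b : 'cV[R]_2) : double_sector a b a.
  by exists 1, 0; rewrite mulr0 scale1r scale0r addr0.
have key (N : 'M[R]_2) x l : x != 0 -> absum N = absum M ->
    l * enorm x <= enorm (N *m x) -> l <= 2 * absum M.
  move=> x0 <- h; rewrite -(ler_pM2r (enorm_gt0 x0)); apply: le_trans h _.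
  apply: le_trans (enorm_le_absum _) _; apply: le_trans (absumM _ _) _.
  by rewrite [2 * _]mulrC -mulrA ler_wpM2l ?absum_ge0 ?absum_le_enorm.
rewrite /Num.max; case: ifP => _.
- apply: (key M u) => //; first exact: (row_mx_unit_neq0 uT).1.
  rewrite /M; suff: double_sector u v (real_mx R (cocycle A B w n) *m u) /\
    lamE ^+ n * enorm u <= enorm (real_mx R (cocycle A B w n) *m u) by case.
  have exg b : expansion_cone (real_mx R (gen A B b)) lamE (double_sector u v).
    by apply: exE; case: b; [right | left].
  elim: n {dM M key} => [|n [IH1 IH2]] /=.
    by rewrite /real_mx map_mx1 !mul1mx mul1r.
  rewrite real_mxM -mulmxA; case: (exg (w n)) => inv ex _; split; first exact: inv.
  apply: le_trans (ex _ IH1); rewrite exprS -mulrA ler_wpM2l //.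
  by rewrite ltW // (lt_trans ltr01).
- have exg b : contraction_cone (real_mx R (gen A B b)) lamC (double_sector u' v').
    by apply: exC; case: b; [right | left].
  apply: (key (invmx M) u'); [exact: (row_mx_unit_neq0 uT').1 | |].
    by rewrite invmx_det1 // absum_adj.
  (* The claim is generalized over the cone because the inverse of the last factor acts first. *)
  suff h x : double_sector u' v' x ->
      lamC^-1 ^+ n * enorm x <= enorm (invmx M *m x) by exact: h (edge _ _).
  rewrite /M; elim: n {dM M key} x => [|n IH] x Cx /=.
    by rewrite /real_mx map_mx1 invmx1 !mul1mx mul1r.
  case: (exg (w n)) => inv ex _.
  have ug b : real_mx R (gen A B b) \in unitmx.
    by rewrite unitmx_det1 // det_real_mx // det_gen.
  have uc : real_mx R (cocycle A B w n) \in unitmx.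
    by rewrite unitmx_det1 // det_real_mx // det_cocycle.
  have -> : invmx (real_mx R (gen A B (w n) *m cocycle A B w n)) *m x =
    invmx (real_mx R (cocycle A B w n)) *m (invmx (real_mx R (gen A B (w n))) *m x).
    rewrite real_mxM; apply: (can_inj (mulKmx uc)); apply: (can_inj (mulKmx (ug (w n)))).
    rewrite [in RHS](mulKVmx uc) [in RHS](mulKVmx (ug _)) mulmxA mulKVmx //.
    by rewrite unitmx_mul ug.
  apply: (le_trans _ (IH _ (inv _ Cx))); rewrite exprSr -mulrA ler_wpM2l ?ex //.
  by rewrite exprn_ge0 // invr_ge0 ltW.
Qed.
End Cones.

(** * Lyapunov exponents *)

Section SingularValues.
Variable R : realType.
Implicit Types (M N : 'M[R]_2) (u v x y z : 'cV[R]_2).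

Lemma det_expmx (X : 'M[R]_2) k : \det (X ^+ k) = \det X ^+ k.
Proof.
elim: k => [|k IH]; first by rewrite !expr0 det1.
by rewrite !exprS -IH -det_mulmx.
Qed.

Lemma trace2E (X : 'M[R]_2) : \tr X = X 0 0 + X 1 1.
Proof. by rewrite /mxtrace sum2E. Qed.

(** The Cayley-Hamilton identity in determinant 1. *)
Lemma sqr_mx_det1 (X : 'M[R]_2) : \det X = 1 -> X * X = \tr X *: X - 1.
Proof.
rewrite det2E trace2E => d; apply/matrixP => i j.
rewrite [LHS](mulmx2E X X) !mxE.
case: (ord2P i) (ord2P j) => -> [] ->; rewrite /=.
- by rewrite (_ : true%:R = 1 :> R) // -d; ring.
- by rewrite (_ : false%:R = 0 :> R) //; ring.
- by rewrite (_ : false%:R = 0 :> R) //; ring.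
- by rewrite (_ : true%:R = 1 :> R) // -d; ring.
Qed.

(** By Cayley-Hamilton the traces of the powers satisfy the recursion with characteristic roots [s]
    and [s^-1]; the induction carries two consecutive traces. *)
Lemma trace_expmx_det1 (X : 'M[R]_2) (s : R) k : s != 0 -> \det X = 1 ->
  \tr X = s + s^-1 -> \tr (X ^+ k) = s ^+ k + s^-1 ^+ k.
Proof.
move=> s0 d t; suff: \tr (X ^+ k) = s ^+ k + s^-1 ^+ k /\
  \tr (X ^+ k.+1) = s ^+ k.+1 + s^-1 ^+ k.+1 by case.
elim: k => [|k [IH1 IH2]].
  by rewrite !expr0 !expr1 mxtrace1.
split=> //; have -> : X ^+ k.+2 = \tr X *: X ^+ k.+1 - X ^+ k.
  by rewrite !exprS mulrA sqr_mx_det1 // mulrBl mul1r -scalerAl.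
rewrite mxtraceD mxtraceZ raddfN /= IH1 IH2 t !exprS.
by field.
Qed.

(** [s] is the larger root of [x ^+ 2 - \tr S * x + 1], whose discriminant is a sum of squares by
    symmetry of [S]. *)
Lemma psd_det1_trace (S : 'M[R]_2) : S^T = S -> \det S = 1 -> 0 <= \tr S ->
  exists2 s : R, 1 <= s & \tr S = s + s^-1.
Proof.
move=> sS; have e : S 0 1 = S 1 0 by rewrite -[in LHS]sS mxE.
rewrite det2E trace2E -e; move: (S 0 0) (S 1 1) (S 0 1) => a b c d t0.
have d4 : 0 <= (a + b) ^+ 2 - 4.
  have -> : (a + b) ^+ 2 - 4 = (a - b) ^+ 2 + (2 * c) ^+ 2.
    by rewrite !expr2; lra.
  by rewrite addr_ge0 ?sqr_ge0.
pose h := Num.sqrt ((a + b) ^+ 2 - 4).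
have hh : h ^+ 2 = (a + b) ^+ 2 - 4 by rewrite sqr_sqrtr.
have h0 : 0 <= h by exact: sqrtr_ge0.
have t2 : 2 <= a + b by nra.
have s1 : 1 <= (a + b + h) / 2 by lra.
exists ((a + b + h) / 2) => //.
have -> : ((a + b + h) / 2)^-1 = (a + b - h) / 2; last by field.
apply: (mulfI (lt0r_neq0 (lt_le_trans ltr01 s1))).
rewrite divff ?lt0r_neq0 // ?(lt_le_trans ltr01 s1) //.
have -> : (a + b + h) / 2 * ((a + b - h) / 2) = ((a + b) ^+ 2 - h ^+ 2) / 4 by field.
by rewrite hh; field.
Qed.

(** The squared Frobenius norm, that is, the sum of the squared singular values. *)
Definition sqsum (M : 'M[R]_2) : R := \tr (M^T *m M).

Lemma sqsumE M : sqsum M = (M 0 0 ^+ 2 + M 1 0 ^+ 2) + (M 0 1 ^+ 2 + M 1 1 ^+ 2).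
Proof. by rewrite /sqsum trace2E !mulmx2E !mxE -!expr2. Qed.

Lemma sqsum_le_absum M : sqsum M <= absum M ^+ 2.
Proof.
rewrite sqsumE absum2E -![M _ _ ^+ 2]real_normK ?num_real //.
move: (normr_ge0 (M 0 0)) (normr_ge0 (M 0 1)) (normr_ge0 (M 1 0)) (normr_ge0 (M 1 1)).
by nra.
Qed.

Lemma absum_le_sqsum M : absum M ^+ 2 <= 4 * sqsum M.
Proof.
rewrite sqsumE absum2E -![M _ _ ^+ 2]real_normK ?num_real //.
move: `|M 0 0| `|M 0 1| `|M 1 0| `|M 1 1| => a b c d.
have := sqr_ge0 (a - b); have := sqr_ge0 (a - c); have := sqr_ge0 (a - d).
have := sqr_ge0 (b - c); have := sqr_ge0 (b - d); have := sqr_ge0 (c - d).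
by rewrite !sqrrB !sqrrD; lra.
Qed.

(** The eigenvalues of [S] are [s] and [s^-1], and the trace of [S ^+ n.*2] is the squared Frobenius
    norm of [M]. The even power only yields [\det S = 1] or [\det S = -1]; positivity excludes the
    latter. *)
Lemma psd_root_singular_value (S M : 'M[R]_2) n : (0 < n)%N -> \det M = 1 ->
  S^T = S -> (forall x : 'cV[R]_2, 0 <= (x^T *m S *m x) 0 0) ->
  S ^+ n.*2 = M^T *m M ->
  \det S = 1 /\ exists2 s : R, 1 <= s &
    \tr S = s + s^-1 /\ sqsum M = s ^+ n.*2 + s^-1 ^+ n.*2.
Proof.
move=> n0 dM sS psd pS.
have e : S 0 1 = S 1 0 by rewrite -[in LHS]sS mxE.
have q a b : 0 <= a ^+ 2 * S 0 0 + 2 * (a * b) * S 0 1 + b ^+ 2 * S 1 1.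
  have := psd (vec2 a b); rewrite !mulmx2E !mxE /= -e.
  by congr (0 <= _); ring.
have a0 : 0 <= S 0 0 by have := q 1 0; rewrite !expr2; lra.
have d0 : 0 <= S 1 1 by have := q 0 1; rewrite !expr2; lra.
have dS2 : \det S ^+ n.*2 = 1 by rewrite -det_expmx pS det_mulmx det_tr dM mulr1.
have dS : \det S = 1.
  have : \det S ^+ 2 = 1.
    have /eqP := dS2; rewrite -mul2n exprM pexpr_eq1 ?sqr_ge0 //.
    by move/eqP.
  move/eqP; rewrite sqrf_eq1 => /orP[/eqP // | /eqP].
  rewrite det2E -e => h.
  (* If the determinant is [-1], the form at [(- S 0 1, S 0 0)] equals [- S 0 0], so [S 0 0 = 0];
     the other vector then gives the negative value [- S 1 1 - 2]. *)
  have := q (- (S 0 1 * (S 1 1 + 1))) 1; have := q (- S 0 1) (S 0 0).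
  move: (S 0 0) (S 1 1) (S 0 1) h a0 d0 => a b c h a0 b0.
  have -> : (- c) ^+ 2 * a + 2 * (- c * a) * c + a ^+ 2 * b = a * (a * b - c * c) by ring.
  rewrite h mulrN1 oppr_ge0 => a0'; have az : a = 0 by apply/le_anti; rewrite a0 a0'.
  have cc : c * c = 1 by move: h; rewrite az; lra.
  have -> : (- (c * (b + 1))) ^+ 2 * a + 2 * (- (c * (b + 1)) * 1) * c + 1 ^+ 2 * b =
    (b + 1) ^+ 2 * a * (c * c) - 2 * (b + 1) * (c * c) + b by ring.
  by rewrite az cc; lra.
have t0 : 0 <= \tr S by rewrite trace2E addr_ge0.
have [s s1 ts] := psd_det1_trace sS dS t0.
split=> //; exists s => //; split=> //.
rewrite /sqsum -pS; apply: trace_expmx_det1 => //.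
by rewrite lt0r_neq0 // (lt_le_trans ltr01).
Qed.

Lemma cvg_mx_coord m n (S : nat -> 'M[R]_(m.+1, n.+1)) (L : 'M[R]_(m.+1, n.+1)) i j :
  S k @[k --> \oo] --> L -> (S k) i j @[k --> \oo] --> L i j.
Proof.
by move=> h; apply: (cvg_comp S (fun X : 'M[R]_(m.+1, n.+1) => X i j) h); exact: coord_continuous.
Qed.

Lemma eigenvalue_det1 (L : 'M[R]_2) a : \det L = 1 -> a != 0 ->
  eigenvalue L a = (\tr L == a + a^-1).
Proof.
move=> dL a0.
have -> : eigenvalue L a = (\det (L - a%:M) == 0).
  apply/eigenvalueP/det0P => -[v].
    by move=> e v0; exists v => //; rewrite mulmxBr e mul_mx_scalar subrr.
  by move=> v0 e; exists v => //; apply/eqP; rewrite -subr_eq0 -mul_mx_scalar -mulmxBr e.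
have -> : \det (L - a%:M) = a * (a + a^-1 - \tr L).
  move: dL; rewrite !det2E trace2E !mxE /= => dL.
  have -> : a * (a + a^-1 - (L 0 0 + L 1 1)) = a * a + 1 - a * (L 0 0 + L 1 1) by field.
  by rewrite -dL mulr1n mulr0n; ring.
by rewrite mulf_eq0 (negbTE a0) /= subr_eq0 eq_sym.
Qed.

(** Trace and determinant are continuous in the entries, so [L] has determinant 1 and the
    eigenvalues [expR chi] and [expR (- chi)]; maximality of [chi] gives [0 <= chi]. Here [t n] is
    the trace of the root [S n]. *)
Lemma lyapunov_singular_values (A B : 'M[int]_2) w (L : 'M[R]_2) chi :
  \det A = 1 -> \det B = 1 -> oseledets_limit A B w L ->
  eigenvalue L (expR chi) ->
  (forall chi', eigenvalue L (expR chi') -> chi' <= chi) ->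
  0 <= chi /\ exists s t : nat -> R,
    (forall n, (0 < n)%N -> [/\ 1 <= s n, t n = s n + (s n)^-1 &
       sqsum (real_mx R (cocycle A B w n)) = s n ^+ n.*2 + (s n)^-1 ^+ n.*2]) /\
    t n @[n --> \oo] --> expR chi + expR (- chi).
Proof.
move=> dA dB [S [hS cS]] eL mL.
have hs n : exists s, (0 < n)%N -> \det (S n) = 1 /\ [/\ 1 <= s, \tr (S n) = s + s^-1 &
     sqsum (real_mx R (cocycle A B w n)) = s ^+ n.*2 + s^-1 ^+ n.*2].
  have [n0|] := ltnP 0 n; last by exists 1.
  have [sS psd pS] := hS n n0.
  have dM := det_real_mx R (det_cocycle w n dA dB).
  have [dS [s s1 [ts qs]]] := psd_root_singular_value n0 dM sS psd pS.
  by exists s.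
have {hs}[s hs] := boolp.choice hs.
have dL : \det L = 1.
  have c1 : \det (S n) @[n --> \oo] --> \det L.
    rewrite det2E (_ : (fun n => _) = (fun n =>
      S n 0 0 * S n 1 1 - S n 0 1 * S n 1 0)); last by apply/funext => n; rewrite det2E.
    by apply: cvgB; apply: cvgM; exact: cvg_mx_coord.
  rewrite -(cvg_lim _ c1) //; apply/cvg_lim => //.
  apply: cvg_near_cst; exists 1%N => // n /= n0.
  by have [] := hs n n0.
have ct : \tr (S n) @[n --> \oo] --> \tr L.
  rewrite trace2E (_ : (fun n => _) = (fun n => S n 0 0 + S n 1 1)); last first.
    by apply/funext => n; rewrite trace2E.
  by apply: cvgD; exact: cvg_mx_coord.
have eN : expR (- chi) = (expR chi)^-1 by rewrite expRN.
have e0 a : expR a != 0 :> R by rewrite gt_eqF ?expR_gt0.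
have trL : \tr L = expR chi + expR (- chi).
  by move: eL; rewrite eigenvalue_det1 // eN => /eqP.
split.
  have := mL (- chi); rewrite eigenvalue_det1 //.
  by rewrite trL eN invrK addrC eqxx => /(_ isT); lra.
exists s, (fun n => \tr (S n)); split; last by rewrite -trL.
by move=> n n0; have [_] := hs n n0.
Qed.

(** Used to pass between inequalities for the traces [s + s^-1] and inequalities for [s]. *)
Lemma addV_incr (a b : R) : 1 <= a -> a < b -> a + a^-1 < b + b^-1.
Proof.
move=> a1 ab; have a0 : 0 < a by lra.
have b0 : 0 < b by lra.
rewrite -subr_gt0.
have -> : b + b^-1 - (a + a^-1) = (b - a) * (a * b - 1) / (a * b) by field; lra.
by rewrite divr_gt0 ?mulr_gt0 //; nra.
Qed.

Lemma bernoulli_ineq (h : R) n : 0 <= h -> 1 + h *+ n <= (1 + h) ^+ n.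
Proof.
move=> h0; elim: n => [|n IH]; first by rewrite mulr0n addr0 expr0.
rewrite exprS mulrS; have := ler_wpM2l (addr_ge0 ler01 h0) IH.
have : 0 <= h * (h *+ n) by rewrite mulr_ge0 ?mulrn_wge0.
by lra.
Qed.

(** * Growth of the cocycle and the Lyapunov exponent *)

Section Lyapunov.
Variables (A B : 'M[int]_2) (w : Omega) (L : 'M[R]_2) (chi : R).
Hypotheses (dA : \det A = 1) (dB : \det B = 1) (oL : oseledets_limit A B w L).
Hypotheses (eL : eigenvalue L (expR chi))
  (mL : forall chi', eigenvalue L (expR chi') -> chi' <= chi).

(** Otherwise, with [y] strictly between [expR chi] and [lam], eventually [s n < y], and the ratio
    [lam / y > 1] would have bounded even powers. *)
Lemma growth_rate_le_lyapunov (lam c : R) : 1 <= lam -> 0 < c ->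
  (forall n, lam ^+ n <= c * absum (real_mx R (cocycle A B w n))) ->
  lam <= expR chi.
Proof.
move=> lam1 c0 gr; rewrite leNgt; apply/negP => lt.
have [chi0 [s [t [hs ct]]]] := lyapunov_singular_values dA dB oL eL mL.
pose y := (expR chi + lam) / 2.
have e1 : 1 <= expR chi by rewrite -expR0 ler_expR.
have ey : expR chi < y by rewrite /y; lra.
have yl : y < lam by rewrite /y; lra.
have y0 : 0 < y by lra.
have lim : expR chi + expR (- chi) < y + y^-1 by rewrite expRN addV_incr.
have [N _ hN] := cvgr_lt _ ct _ lim.
(* In [8 = 4 * 2], the 4 compares [absum] with the Frobenius norm and the 2 counts the powers of
   [s n] and of its inverse, each at most [y ^+ n.*2]. *)
have ub n : (N <= n)%N -> (0 < n)%N -> (lam / y) ^+ n.*2 <= c ^+ 2 * 8.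
  move=> Nn n0; have [s1 tn qn] := hs n n0.
  have sy : s n < y.
    rewrite ltNge; apply/negP => ys; have := hN n Nn; rewrite /= tn ltNge.
    move/negP; apply; move: ys; rewrite le_eqVlt => /orP[/eqP <- // | ys].
    by apply/ltW/addV_incr => //; lra.
  have sn0 : 0 < s n by lra.
  rewrite expr_div_n ler_pdivrMr ?exprn_gt0 //.
  have h1 : lam ^+ n.*2 <= c ^+ 2 * absum (real_mx R (cocycle A B w n)) ^+ 2.
    rewrite -exprMn -muln2 exprM ler_pXn2r ?nnegrE ?gr ?exprn_ge0 //; first lra.
    by rewrite mulr_ge0 ?absum_ge0 // ltW.
  apply: le_trans h1 _; rewrite -[leRHS]mulrA; apply: ler_wpM2l; first exact: sqr_ge0.
  apply: le_trans (absum_le_sqsum _) _; rewrite qn.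
  have p1 : s n ^+ n.*2 <= y ^+ n.*2 by rewrite ler_pXn2r ?nnegrE ?ltW // -muln2 muln_gt0 n0.
  have p2 : (s n)^-1 ^+ n.*2 <= y ^+ n.*2.
    apply: le_trans p1; apply: (@le_trans _ _ 1); last exact: exprn_ege1.
    by rewrite exprn_ile1 ?invr_ge0 ?invf_le1 // ltW.
  by lra.
pose h := lam / y - 1.
have h0 : 0 < h by rewrite /h subr_gt0 ltr_pdivlMr ?mul1r.
(* At time [(k + N).+1] Bernoulli's inequality contradicts the bound. *)
pose k := Num.bound (c ^+ 2 * 8 / h).
have kb : c ^+ 2 * 8 / h < k%:R.
  by apply: archi_boundP; rewrite divr_ge0 ?mulr_ge0 ?sqr_ge0 // ltW.
have := ub (k + N).+1 ltac:(lia) isT.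
apply/negP; rewrite -ltNge.
have -> : lam / y = 1 + h by rewrite /h addrC subrK.
apply: lt_le_trans (bernoulli_ineq _ (ltW h0)).
move: kb; rewrite ltr_pdivrMr // => kb; apply: (lt_le_trans kb).
rewrite mulr_natl -[leLHS]add0r lerD // ler_wpMn2l ?(ltW h0) //.
by rewrite -addnn; lia.
Qed.

(** Eventually [expR (chi - eps) <= s n], and the finitely many earlier times only affect the
    constant. *)
Lemma lyapunov_growth eps : 0 < eps ->
  exists2 C : R, 0 < C & forall n,
    C * expR ((chi - eps) * n%:R) <= absum (real_mx R (cocycle A B w n)).
Proof.
move=> eps0.
have [chi0 [s [t [hs ct]]]] := lyapunov_singular_values dA dB oL eL mL.
pose y := expR (chi - eps).
have [N hN] : exists N : nat, forall n, (N < n)%N -> y <= s n.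
  (* The comparison of [x + x^-1] is available only for [x >= 1]; for [y <= 1] the bound [1 <= s n]
     suffices. *)
  have [y1|y1] := lerP y 1.
    by exists 0%N => n n0; have [s1 _ _] := hs n n0; exact: le_trans s1.
  have lim : y + y^-1 < expR chi + expR (- chi).
    by rewrite expRN addV_incr ?(ltW y1) // ltr_expR; lra.
  have [N _ hN] := cvgr_gt _ ct _ lim.
  exists N => n Nn; have n0 : (0 < n)%N by apply: leq_ltn_trans Nn.
  have [s1 tn _] := hs n n0; rewrite leNgt; apply/negP => sy.
  have := hN n (ltnW Nn); rewrite /= tn ltNge => /negP; apply.
  exact/ltW/addV_incr.
have big n : (N < n)%N -> expR ((chi - eps) * n%:R) <= absum (real_mx R (cocycle A B w n)).
  move=> Nn; have n0 : (0 < n)%N by apply: leq_ltn_trans Nn.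
  have [s1 _ qn] := hs n n0; rewrite mulrC expRM_natl -/y.
  rewrite -(@ler_pXn2r _ 2) ?nnegrE ?exprn_ge0 ?absum_ge0 ?expR_ge0 //.
  apply: le_trans (sqsum_le_absum _); rewrite qn -exprM muln2.
  have sn0 : 0 < s n by lra.
  apply: (@le_trans _ _ (s n ^+ n.*2)).
    by rewrite ler_pXn2r ?nnegrE ?expR_ge0 ?hN ?ltW // -muln2 muln_gt0 n0.
  by rewrite lerDl exprn_ge0 // invr_ge0 ltW.
(* The product is nonzero, since multiplied by its adjugate it gives the identity. *)
have pos n : 0 < absum (real_mx R (cocycle A B w n)) / expR ((chi - eps) * n%:R).
  rewrite divr_gt0 ?expR_gt0 //; rewrite lt_neqAle absum_ge0 andbT eq_sym.
  apply/eqP => a0; have := absumM (real_mx R (cocycle A B w n)) (\adj (real_mx R (cocycle A B w n))).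
  rewrite a0 mul0r mul_mx_adj det_real_mx ?det_cocycle // absum2E !mxE /= normr1 normr0.
  by lra.
have [m m0 hm] := finite_pos_lower_bound (fun i : 'I_N.+1 => pos i).
(* [m] serves the times up to [N], and 1 the later ones. *)
exists (Num.min m 1); first by rewrite lt_min m0 ltr01.
move=> n; have [nN|nN] := leqP n N.
  rewrite -ler_pdivlMr ?expR_gt0 //; apply: le_trans (hm (Ordinal (nN : (n < N.+1)%N))).
  by rewrite ge_min lexx.
apply: le_trans (big _ nN); rewrite ler_piMl ?expR_ge0 //.
by rewrite ge_min lexx orbT.
Qed.

End Lyapunov.
End SingularValues.

(** * Complex-valued integrals *)

Local Notation Re := complex.Re.
Local Notation Im := complex.Im.

Section ComplexPart.
Variable R : realType.
Implicit Types (x y c : R[i]).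

Lemma ReD x y : Re (x + y) = Re x + Re y. Proof. by case: x; case: y. Qed.
Lemma ImD x y : Im (x + y) = Im x + Im y. Proof. by case: x; case: y. Qed.
Lemma ReN x : Re (- x) = - Re x. Proof. by case: x. Qed.
Lemma ImN x : Im (- x) = - Im x. Proof. by case: x. Qed.
Lemma ReM x y : Re (x * y) = Re x * Re y - Im x * Im y.
Proof. by case: x; case: y. Qed.
Lemma ImM x y : Im (x * y) = Re x * Im y + Im x * Re y.
Proof. by case: x; case: y => a b c d /=; rewrite addrC. Qed.

Lemma complex_ext x y : Re x = Re y -> Im x = Im y -> x = y.
Proof. by case: x y => a b [c d] /= -> ->. Qed.

Lemma normcE x : Normc.normc x = Num.sqrt (Re x ^+ 2 + Im x ^+ 2).
Proof. by case: x. Qed.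

Lemma normc_ge0 x : 0 <= Normc.normc x.
Proof. by rewrite normcE sqrtr_ge0. Qed.

Lemma Re_le_normc x : `|Re x| <= Normc.normc x.
Proof. by rewrite normcE -sqrtr_sqr ler_wsqrtr // lerDl sqr_ge0. Qed.

Lemma Im_le_normc x : `|Im x| <= Normc.normc x.
Proof. by rewrite normcE -sqrtr_sqr ler_wsqrtr // lerDr sqr_ge0. Qed.

Lemma normc_le_ReIm x : Normc.normc x <= `|Re x| + `|Im x|.
Proof.
rewrite normcE -[leRHS]ger0_norm ?addr_ge0 // -sqrtr_sqr ler_wsqrtr //.
rewrite sqrrD !real_normK ?num_real //.
by have := mulr_ge0 (normr_ge0 (Re x)) (normr_ge0 (Im x)); lra.
Qed.

Lemma normc_sum (I : Type) (s : seq I) (P : pred I) (F : I -> R[i]) :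
  Normc.normc (\sum_(i <- s | P i) F i) <= \sum_(i <- s | P i) Normc.normc (F i).
Proof.
elim/big_ind2: _ => [|x1 x2 y1 y2 h1 h2|//]; first by rewrite Normc.normc0.
by apply: le_trans (lerD h1 h2); exact: le_normcD.
Qed.

Lemma cexp0 : cexp (0 : R) = 1.
Proof. by rewrite /cexp cos0 sin0. Qed.

Lemma normc_cexp (t : R) : Normc.normc (cexp t) = 1.
Proof. by rewrite normcE /= cos2Dsin2 sqrtr1. Qed.

(** Carries a uniform bound for the correlations of partial sums over to the limit. *)
Lemma normc_le_cvg (z : nat -> R[i]) (l m : R[i]) (b : R) :
  Re (z n) @[n --> \oo] --> Re l -> Im (z n) @[n --> \oo] --> Im l ->
  (forall n, Normc.normc (z n - m) <= b) -> Normc.normc (l - m) <= b.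
Proof.
move=> cr ci zb; apply/ler_addgt0Pr => e e0.
have e2 : 0 < e / 2 by rewrite divr_gt0.
have [n [rn imn]] : exists n, `|Re l - Re (z n)| < e / 2 /\ `|Im l - Im (z n)| < e / 2.
  move/cvgrPdist_lt: cr => /(_ _ e2) hr; move/cvgrPdist_lt: ci => /(_ _ e2) hi.
  have : \forall n \near \oo, `|Re l - Re (z n)| < e / 2 /\ `|Im l - Im (z n)| < e / 2.
    by near=> n; split; near: n.
  by move/filter_ex.
have -> : l - m = (z n - m) + (l - z n) by ring.
apply: le_trans (le_normcD _ _) _; apply: lerD => //.
apply: le_trans (normc_le_ReIm _) _; rewrite ReD ImD ReN ImN.
by rewrite (splitr e) ltW // ltrD.
Unshelve. all: by end_near.
Qed.

End ComplexPart.

Section ComplexIntegral.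
Variable R : realType.
Context d (T : measurableType d) (mu : {measure set T -> \bar R}) (D : set T).
Hypothesis mD : measurable D.
Implicit Types (h k e : T -> R[i]) (c : R[i]).

Definition cintegrable h :=
  mu.-integrable D (EFin \o (fun z => Re (h z))) /\
  mu.-integrable D (EFin \o (fun z => Im (h z))).

Definition cmeasurable h :=
  measurable_fun D (fun z => Re (h z)) /\ measurable_fun D (fun z => Im (h z)).

Definition cint h : R[i] :=
  (Rintegral mu D (fun z => Re (h z)) +i* Rintegral mu D (fun z => Im (h z)))%C.

Lemma cintegrable_measurable h : cintegrable h -> cmeasurable h.
Proof.
by move=> [hr hi]; split; apply/measurable_EFinP;
  [exact: measurable_int hr | exact: measurable_int hi].
Qed.

Lemma cmeasurableM e h : cmeasurable e -> cmeasurable h ->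
  cmeasurable (fun z => e z * h z).
Proof.
move=> [er ei] [hr hi]; split.
  rewrite (_ : (fun z => _) = (fun z => Re (e z) * Re (h z) - Im (e z) * Im (h z))).
    by apply: measurable_funB; apply: measurable_funM.
  by apply/funext => z; rewrite ReM.
rewrite (_ : (fun z => _) = (fun z => Re (e z) * Im (h z) + Im (e z) * Re (h z))).
  by apply: measurable_funD; apply: measurable_funM.
by apply/funext => z; rewrite ImM.
Qed.

(** The majorant [|Re h| + |Im h|] stands in for the modulus of [h], because its integrability is
    immediate from that of the two parts. *)
Lemma cintegrable_dominated e h (b : R) : 0 <= b -> cmeasurable e -> cintegrable h ->
  (forall z, D z -> Normc.normc (e z) <= b * Normc.normc (h z)) -> cintegrable e.
Proof.
move=> b_ge0 [er ei] [hr hi] dom.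
have ig : mu.-integrable D (EFin \o (fun z => b * (`|Re (h z)| + `|Im (h z)|))).
  rewrite (_ : EFin \o _ = (fun z => b%:E * ((abse \o (EFin \o (fun z => Re (h z)))) \+
      (abse \o (EFin \o (fun z => Im (h z))))) z)%E) //.
  apply: integrableZl => //; apply: integrableD => //; exact: integrable_abse.
have b0 z : D z -> Normc.normc (e z) <= `|b * (`|Re (h z)| + `|Im (h z)|)|.
  move=> Dz; apply: le_trans (dom z Dz) _.
  by rewrite ger0_norm ?mulr_ge0 ?addr_ge0 // ler_wpM2l // normc_le_ReIm.
split.
- apply: (le_integrable mD _ _ ig); first exact/measurable_EFinP.
  by move=> z Dz /=; rewrite lee_fin; apply: le_trans (b0 z Dz); exact: Re_le_normc.
- apply: (le_integrable mD _ _ ig); first exact/measurable_EFinP.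
  by move=> z Dz /=; rewrite lee_fin; apply: le_trans (b0 z Dz); exact: Im_le_normc.
Qed.

Lemma cintegrableZ c h : cintegrable h -> cintegrable (fun z => c * h z).
Proof.
move=> ih; apply: (@cintegrable_dominated _ h (Normc.normc c)); first exact: normc_ge0.
- apply: cmeasurableM; last exact: cintegrable_measurable.
  by split; exact: measurable_cst.
- exact: ih.
- by move=> z _; rewrite Normc.normcM.
Qed.

Lemma cintegrableD h k : cintegrable h -> cintegrable k ->
  cintegrable (fun z => h z + k z).
Proof.
move=> [hr hi] [kr ki]; split.
  rewrite (_ : EFin \o _ = (EFin \o (fun z => Re (h z))) \+ (EFin \o (fun z => Re (k z))))%E.
    exact: integrableD.
  by apply/funext => z /=; rewrite ReD.
rewrite (_ : EFin \o _ = (EFin \o (fun z => Im (h z))) \+ (EFin \o (fun z => Im (k z))))%E.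
  exact: integrableD.
by apply/funext => z /=; rewrite ImD.
Qed.

Lemma cintegrable0 : cintegrable (fun=> 0).
Proof. by split; apply: integrable0. Qed.

Lemma cintegrable_sum (I : Type) (s : seq I) (F : I -> T -> R[i]) :
  (forall i, cintegrable (F i)) -> cintegrable (fun z => \sum_(i <- s) F i z).
Proof.
move=> iF; elim: s => [|i s IH].
  by under eq_fun do rewrite big_nil; exact: cintegrable0.
by under eq_fun do rewrite big_cons; exact: cintegrableD.
Qed.

Lemma cintD h k : cintegrable h -> cintegrable k ->
  cint (fun z => h z + k z) = cint h + cint k.
Proof.
move=> [hr hi] [kr ki]; apply: complex_ext; rewrite ?ReD ?ImD /=.
  by rewrite -RintegralD //; apply: eq_Rintegral => z _; rewrite ReD.
by rewrite -RintegralD //; apply: eq_Rintegral => z _; rewrite ImD.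
Qed.

Lemma cintZ c h : cintegrable h -> cint (fun z => c * h z) = c * cint h.
Proof.
move=> [hr hi].
have iZ (r : R) (f : T -> R) : mu.-integrable D (EFin \o f) ->
    mu.-integrable D (EFin \o (fun z => r * f z)) by exact: integrableZl.
apply: complex_ext; rewrite ?ReM ?ImM /= -!RintegralZl //.
  by rewrite -RintegralB ?iZ //; apply: eq_Rintegral => z _; rewrite ReM.
by rewrite -RintegralD ?iZ //; apply: eq_Rintegral => z _; rewrite ImM.
Qed.

Lemma cint_sum (I : Type) (s : seq I) (F : I -> T -> R[i]) :
  (forall i, cintegrable (F i)) ->
  cint (fun z => \sum_(i <- s) F i z) = \sum_(i <- s) cint (F i).
Proof.
move=> iF; elim: s => [|i s IH].
  under eq_fun do rewrite big_nil; rewrite big_nil; apply: complex_ext;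
    by rewrite /= Rintegral_cst // mul0r.
under eq_fun do rewrite big_cons.
by rewrite big_cons cintD ?IH //; exact: cintegrable_sum.
Qed.

Lemma Rintegral_dominated_cvg (f_ : nat -> T -> R) (f g : T -> R) :
  (forall n, measurable_fun D (f_ n)) -> measurable_fun D f ->
  (forall z, D z -> f_ n z @[n --> \oo] --> f z) ->
  mu.-integrable D (EFin \o g) -> (forall n z, D z -> `|f_ n z| <= g z) ->
  Rintegral mu D (f_ n) @[n --> \oo] --> Rintegral mu D f.
Proof.
move=> mf_ mf cf ig dom.
have [ifi _ cv] := @dominated_convergence _ T R mu D mD (fun n => EFin \o f_ n) (EFin \o f)
  (EFin \o g) (fun n => (measurable_EFinP _ _).2 (mf_ n)) ((measurable_EFinP _ _).2 mf)
  ltac:(by apply: aeW => z Dz; apply/cvg_EFin; [exact: nearW | exact: cf])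
  ig ltac:(by apply: aeW => z n Dz; rewrite lee_fin; exact: dom).
apply: fine_cvg; rewrite fineK; first exact: cv.
exact: integrable_fin_num.
Qed.

(** Measurability of the limit [h] comes from the pointwise convergence; in the application [h]
    involves an observable composed with the cocycle, which is reached through its Fourier
    series. *)
Lemma cint_dominated_cvg (h_ : nat -> T -> R[i]) h k (b : R) : 0 <= b ->
  (forall n, cmeasurable (h_ n)) ->
  (forall z, D z -> Normc.normc (h z - h_ n z) @[n --> \oo] --> (0 : R)) ->
  cintegrable k -> (forall n z, D z -> Normc.normc (h_ n z) <= b * Normc.normc (k z)) ->
  Re (cint (h_ n)) @[n --> \oo] --> Re (cint h) /\
  Im (cint (h_ n)) @[n --> \oo] --> Im (cint h).
Proof.
move=> b0 mh ch [kr ki] dom.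
have ig : mu.-integrable D (EFin \o (fun z => b * (`|Re (k z)| + `|Im (k z)|))).
  rewrite (_ : EFin \o _ = (fun z => b%:E * ((abse \o (EFin \o (fun z => Re (k z)))) \+
      (abse \o (EFin \o (fun z => Im (k z))))) z)%E) //.
  apply: integrableZl => //; apply: integrableD => //; exact: integrable_abse.
have dom' n z : D z -> Normc.normc (h_ n z) <= b * (`|Re (k z)| + `|Im (k z)|).
  by move=> Dz; apply: le_trans (dom n z Dz) _; rewrite ler_wpM2l // normc_le_ReIm.
have sq (u : nat -> R) (l : R) (e : nat -> R) :
    (forall n, `|l - u n| <= e n) -> e n @[n --> \oo] --> (0 : R) -> u n @[n --> \oo] --> l.
  move=> ue e0; apply/cvgrPdist_le => eps eps0.
  move/cvgrPdist_le: e0 => /(_ _ eps0); apply: filterS => n /=.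
  rewrite sub0r normrN => h1; apply: le_trans (ue n) _.
  exact: le_trans (ler_norm _) h1.
have cr z : D z -> Re (h_ n z) @[n --> \oo] --> Re (h z).
  move=> Dz; apply: (sq _ _ _ _ (ch z Dz)) => n.
  by rewrite -ReN -ReD Re_le_normc.
have ci z : D z -> Im (h_ n z) @[n --> \oo] --> Im (h z).
  move=> Dz; apply: (sq _ _ _ _ (ch z Dz)) => n.
  by rewrite -ImN -ImD Im_le_normc.
split; apply: Rintegral_dominated_cvg ig _ => //.
- by move=> n; case: (mh n).
- by apply: measurable_fun_cvg cr => n; case: (mh n).
- by move=> n z Dz; apply: le_trans (dom' n z Dz); exact: Re_le_normc.
- by move=> n; case: (mh n).
- by apply: measurable_fun_cvg ci => n; case: (mh n).
- by move=> n z Dz; apply: le_trans (dom' n z Dz); exact: Im_le_normc.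
Qed.

End ComplexIntegral.

(** * Correlations *)

Section Torus.
Variable R : realType.
Local Notation V := 'cV[R]_2.
Local Notation mu := (@lebesgue_measure R).
Local Notation mu2 := (mu \x mu)%E.
Local Notation T2 := (measurableTypeR R * measurableTypeR R)%type.
Local Notation cell := (@torus_cell R : set T2).
Implicit Types (q : 'cV[int]_2) (h F G : V -> R[i]).

(** The integer points of $[-N,N]^2$, listed in the order of [fourier_partial_sum]. *)
Definition lattice_box (N : nat) : seq 'cV[int]_2 :=
  [seq vec2 ((nat_of_ord i)%:Z - N%:Z) ((nat_of_ord j)%:Z - N%:Z)
     | i <- index_enum 'I_N.*2.+1, j <- index_enum 'I_N.*2.+1].

Lemma lattice_box_uniq N : uniq (lattice_box N).
Proof.
apply: allpairs_uniq; rewrite ?index_enum_uniq // => -[i j] [i' j'] _ _ /= /matrixP e.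
have := e 0 0; have := e 1 0; rewrite !mxE /= => /addIr[e1] /addIr[e0].
by congr (_, _); apply/val_inj.
Qed.

Lemma mem0_lattice_box N : 0 \in lattice_box N.
Proof.
have h : (N < N.*2.+1)%N by lia.
apply/allpairsP; exists (Ordinal h, Ordinal h); rewrite !mem_index_enum; split=> //.
by apply/matrixP => i j; rewrite !mxE /= subrr if_same.
Qed.

Lemma fourier_partial_sumE (f : Omega * V -> R[i]) w x N :
  fourier_partial_sum f w x N =
  \sum_(q <- lattice_box N) fourier f w q * cexp (dot q x).
Proof. by rewrite /lattice_box big_allpairs_dep. Qed.

Lemma esum_lattice_box (a : 'cV[int]_2 -> R) N : (forall q, 0 <= a q) ->
  ((\sum_(q <- lattice_box N) a q)%:E <= \esum_(q in [set: 'cV[int]_2]) (a q)%:E)%E.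
Proof.
move=> a0; apply: esum_ge; exists [set` lattice_box N].
  by split=> //; exact: finite_seq.
by rewrite -fsbig_seq ?lattice_box_uniq // sumEFin.
Qed.

Lemma le_esum_term (a : 'cV[int]_2 -> R) q : (forall q, 0 <= a q) ->
  ((a q)%:E <= \esum_(q in [set: 'cV[int]_2]) (a q)%:E)%E.
Proof.
move=> a0; apply: esum_ge; exists [set q]; first by split=> //; exact: finite_set1.
by rewrite fsbig_set1.
Qed.

Lemma measurable_torus_cell : measurable cell.
Proof. by apply: measurableX; exact: measurable_itv. Qed.

Lemma torus_meanE h : torus_mean h = ((2 * pi) ^- 2)%:C%C *
  cint mu2 cell (fun z : T2 => h (vec2 z.1 z.2)).
Proof. by apply: complex_ext; rewrite ?ReM ?ImM /= mul0r ?subr0 ?addr0. Qed.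

Lemma cmeasurable_character q :
  cmeasurable cell (fun z : T2 => cexp (dot q (vec2 z.1 z.2))).
Proof.
have md : measurable_fun cell (fun z : T2 =>
    dot q (vec2 z.1 z.2)).
  rewrite (_ : (fun z => _) = (fun z => (q 0 0)%:~R * z.1 + (q 1 0)%:~R * z.2)); last first.
    by apply/funext => z; rewrite /dot sum2E !mxE.
  apply: measurable_funTS; apply: measurable_funD; exact: measurable_funM.
split; apply: (measurableT_comp _ md).
  by apply: continuous_measurable_fun; exact: continuous_cos.
by apply: continuous_measurable_fun; exact: continuous_sin.
Qed.

Lemma dotN q (x : V) : dot (- q) x = - dot q x.
Proof. by rewrite /dot !sum2E !mxE !rmorphN; ring. Qed.

Lemma dot_mulmx q (M : 'M[int]_2) (x : V) :
  dot q (real_mx R M *m x) = dot (M^T *m q) x.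
Proof.
by rewrite /dot !sum2E !mulmx2E !mxE !rmorphD !rmorphM /=; ring.
Qed.

Lemma dot0 (x : V) : dot 0 x = 0.
Proof. by rewrite /dot sum2E !mxE !mul0r addr0. Qed.

(** The frequency [q] of [F] composed with [M] contributes [Fh q * Gh (- (M^T *m q))]. The term
    [q = 0] is the subtracted product; for the others the weights $|q|^\beta$ and $|M^Tq|^\beta$
    together gain the factor $\delta^{-\beta}$. The bound holds for every partial sum and passes to
    the limit by dominated convergence. *)
Lemma torus_mean_correlation (Fh : 'cV[int]_2 -> R[i]) F G (M : 'M[int]_2)
    (a b beta delta : R) :
  let Gh q := torus_mean (fun x => G x * cexp (- dot q x)) in
  (forall x, Normc.normc (F x - \sum_(q <- lattice_box N) Fh q * cexp (dot q x))
     @[N --> \oo] --> (0 : R)) ->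
  torus_integrable G -> 0 < beta -> 0 < delta ->
  (forall N, \sum_(q <- lattice_box N) Normc.normc (Fh q) * enorm (real_mx R q) `^ beta <= a) ->
  (forall q, Normc.normc (Gh q) * enorm (real_mx R q) `^ beta <= b) ->
  (forall q, q != 0 -> delta <= enorm (real_mx R q) * enorm (real_mx R (M^T *m q))) ->
  Normc.normc (torus_mean (fun x => F (real_mx R M *m x) * G x) - Fh 0 * torus_mean G)
    <= a * b * delta `^ (- beta).
Proof.
move=> Gh cF iG beta0 delta0 Fa Gb Mdelta.
pose P N (z : T2) : R[i] := \sum_(q <- lattice_box N)
   (Fh q * cexp (dot (M^T *m q) (vec2 z.1 z.2))) * G (vec2 z.1 z.2).
pose kap : R[i] := ((2 * pi) ^- 2)%:C%C.
have mD := measurable_torus_cell.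
have mG : cmeasurable cell (fun z : T2 => G (vec2 z.1 z.2)).
  exact: (cintegrable_measurable iG).
have ich q : cintegrable mu2 cell
    (fun z => cexp (dot q (vec2 z.1 z.2)) * G (vec2 z.1 z.2)).
  apply: (@cintegrable_dominated _ _ _ mu2 _ mD _ _ 1 ler01 _ iG).
    exact: cmeasurableM (cmeasurable_character q) mG.
  by move=> z _; rewrite Normc.normcM normc_cexp.
have iterm q : cintegrable mu2 cell
    (fun z => Fh q * cexp (dot (M^T *m q) (vec2 z.1 z.2)) * G (vec2 z.1 z.2)).
  by under eq_fun do rewrite -mulrA; exact: cintegrableZ.
have e1 N : kap * cint mu2 cell (P N) =
   \sum_(q <- lattice_box N) Fh q * Gh (- (M^T *m q)).
  rewrite (cint_sum mD (lattice_box N) iterm : cint mu2 _ (P N) = _) mulr_sumr; apply: eq_bigr => q _.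
  have -> : (fun z : T2 => Fh q * cexp (dot (M^T *m q) (vec2 z.1 z.2)) * G (vec2 z.1 z.2)) =
      (fun z : T2 => Fh q * (cexp (dot (M^T *m q) (vec2 z.1 z.2)) * G (vec2 z.1 z.2))).
    by apply/funext => z; rewrite mulrA.
  rewrite (cintZ mD _ (ich _)) mulrCA /Gh torus_meanE; congr (_ * (_ * cint _ _ _)).
  by apply/funext => z; rewrite dotN opprK mulrC.
have enorm0 : enorm (real_mx R (0 : 'cV[int]_2)) = 0.
  by rewrite /enorm sum2E !mxE expr0n addr0 sqrtr0.
have pow_ge1 q : q != 0 -> 1 <= enorm (real_mx R q) `^ beta.
  move=> q0; apply: (@le_trans _ _ (1 `^ beta)); first by rewrite powR1.
  rewrite ge0_ler_powR ?nnegrE ?enorm_ge0 ?(ltW beta0) //.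
  exact: enorm_int_ge1.
have b0 : 0 <= b.
  by apply: le_trans (Gb 0); rewrite mulr_ge0 ?normc_ge0 ?powR_ge0.
have termb q : q != 0 -> Normc.normc (Fh q * Gh (- (M^T *m q))) <=
    Normc.normc (Fh q) * enorm (real_mx R q) `^ beta * (b * delta `^ (- beta)).
  move=> q0; rewrite Normc.normcM -mulrA ler_wpM2l ?normc_ge0 //.
  set q' := M^T *m q.
  have eN : enorm (real_mx R (- q')) = enorm (real_mx R q').
    by rewrite /enorm !sum2E !mxE !rmorphN !sqrrN.
  have gb := Gb (- q'); rewrite eN in gb.
  have dl := Mdelta q q0; rewrite -/q' in dl.
  have pd : delta `^ beta <= enorm (real_mx R q) `^ beta * enorm (real_mx R q') `^ beta.
    rewrite -powRM ?enorm_ge0 // ge0_ler_powR ?nnegrE ?(ltW beta0) ?(ltW delta0) //.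
    by rewrite mulr_ge0 ?enorm_ge0.
  have dp : 0 < delta `^ beta by rewrite powR_gt0.
  rewrite powRN mulrA ler_pdivlMr //.
  apply: le_trans (ler_wpM2l (normc_ge0 _) pd) _.
  rewrite mulrCA ler_wpM2l ?powR_ge0 //.
have bound N : Normc.normc (kap * cint mu2 cell (P N) - Fh 0 * torus_mean G)
    <= a * b * delta `^ (- beta).
  rewrite e1 (bigD1_seq 0) ?mem0_lattice_box ?lattice_box_uniq //=.
  have -> : Gh (- (M^T *m 0)) = torus_mean G.
    rewrite /Gh mulmx0 oppr0; congr torus_mean; apply/funext => x.
    by rewrite dot0 oppr0 cexp0 mulr1.
  rewrite addrAC subrr add0r; apply: le_trans (normc_sum _ _ _) _.
  apply: (@le_trans _ _ (\sum_(q <- lattice_box N | q != 0)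
      Normc.normc (Fh q) * enorm (real_mx R q) `^ beta * (b * delta `^ (- beta)))).
    by apply: ler_sum => q; exact: termb.
  rewrite -mulr_suml -mulrA ler_wpM2r ?mulr_ge0 ?powR_ge0 //.
  apply: le_trans (Fa N); rewrite [leRHS](bigD1_seq 0) ?mem0_lattice_box ?lattice_box_uniq //=.
  by rewrite lerDr mulr_ge0 ?normc_ge0 ?powR_ge0.
have a0 : 0 <= a.
  apply: le_trans (Fa 0%N); apply: sumr_ge0 => q _.
  by rewrite mulr_ge0 ?normc_ge0 ?powR_ge0.
(* The weight vanishes at [q = 0] and is at least 1 elsewhere, so the constant term is added
   separately; the result dominates the partial sums uniformly. *)
have Fk N : \sum_(q <- lattice_box N) Normc.normc (Fh q) <= Normc.normc (Fh 0) + a.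
  rewrite (bigD1_seq 0) ?mem0_lattice_box ?lattice_box_uniq //= lerD2l.
  apply: le_trans (Fa N); rewrite [leRHS](bigD1_seq 0) ?mem0_lattice_box ?lattice_box_uniq //=.
  rewrite enorm0 powR0 ?gt_eqF // mulr0 add0r; apply: ler_sum => q q0.
  by rewrite ler_peMr ?normc_ge0 ?pow_ge1.
have PE N z : P N z = (\sum_(q <- lattice_box N)
    Fh q * cexp (dot q (real_mx R M *m vec2 z.1 z.2))) * G (vec2 z.1 z.2).
  by rewrite mulr_suml; apply: eq_bigr => q _; rewrite dot_mulmx.
have cvP z : cell z ->
    Normc.normc (F (real_mx R M *m vec2 z.1 z.2) * G (vec2 z.1 z.2) - P N z)
      @[N --> \oo] --> (0 : R).
  move=> _; under eq_fun do rewrite PE -mulrBl Normc.normcM.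
  have -> : nbhs (0 : R) = nbhs (0 * Normc.normc (G (vec2 z.1 z.2))) by rewrite mul0r.
  by apply: cvgM; [exact: cF | exact: cvg_cst].
have domP N z : cell z ->
    Normc.normc (P N z) <= (Normc.normc (Fh 0) + a) * Normc.normc (G (vec2 z.1 z.2)).
  move=> _; rewrite PE Normc.normcM; apply: ler_wpM2r; first exact: normc_ge0.
  apply: le_trans (Fk N); apply: le_trans (normc_sum _ _ _) _.
  by apply: ler_sum => q _; rewrite Normc.normcM normc_cexp mulr1.
have mP N : cmeasurable cell (P N).
  exact: (cintegrable_measurable (cintegrable_sum mD (lattice_box N) iterm)).
have ka0 : 0 <= Normc.normc (Fh 0) + a by rewrite addr_ge0 ?normc_ge0.
have [cr ci] := cint_dominated_cvg mD ka0 mP cvP iG domP.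
have kapRe y : Re (kap * y) = (2 * pi) ^- 2 * Re y by rewrite ReM /= mul0r subr0.
have kapIm y : Im (kap * y) = (2 * pi) ^- 2 * Im y by rewrite ImM /= mul0r addr0.
rewrite torus_meanE -/kap; apply: normc_le_cvg bound; rewrite ?kapRe ?kapIm.
  by under eq_fun do rewrite kapRe; apply: cvgM cr; exact: cvg_cst.
by under eq_fun do rewrite kapIm; apply: cvgM ci; exact: cvg_cst.
Qed.

End Torus.

(** * Both correlations bounded through the orbits of frequencies *)

Section Correlations.
Variable R : realType.
Local Notation V := 'cV[R]_2.
Implicit Types (f g : Omega * V -> R[i]) (w : Omega) (A B : 'M[int]_2).

Lemma iter_shiftE n w (k : nat) : (iter n Defs.shift w : nat -> bool) k = (w : nat -> bool) (n + k)%N.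
Proof.
by elim: n k => //= n IH k; rewrite /Defs.shift /= IH addnS addSn.
Qed.

Lemma iter_skewE A B n w (x : V) :
  iter n (Defs.skew A B) (w, x) = (iter n Defs.shift w, real_mx R (cocycle A B w n) *m x).
Proof.
elim: n => [|n IH] /=; first by rewrite /real_mx map_mx1 mul1mx.
by rewrite IH /Defs.skew /= iter_shiftE addn0 real_mxM mulmxA.
Qed.

Lemma fourier0 f w : fourier f w 0 = torus_mean (fun x => f (w, x)).
Proof.
congr torus_mean; apply/funext => x.
by rewrite dot0 oppr0 cexp0 mulr1.
Qed.

(** Box sums and single coefficients are dominated by the full series, uniformly in [w]; finiteness
    turns the norm into a real number. *)
Lemma strong_holder_normE beta f : strong_holder beta f ->
  exists2 a : R, holder_norm beta f = a%:E & 0 <= a /\ forall w,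
    (forall N, \sum_(q <- lattice_box N)
       Normc.normc (fourier f w q) * enorm (real_mx R q) `^ beta <= a) /\
    (forall q, Normc.normc (fourier f w q) * enorm (real_mx R q) `^ beta <= a).
Proof.
move=> [_ fin _].
pose t w q := Normc.normc (fourier f w q) * enorm (real_mx R q) `^ beta.
have t0 w q : 0 <= t w q by rewrite mulr_ge0 ?normc_ge0 ?powR_ge0.
have le w : (\esum_(q in [set: 'cV[int]_2]) (t w q)%:E <= holder_norm beta f)%E.
  by apply: ereal_sup_ubound; exists w.
have h0 : (0 <= holder_norm beta f)%E.
  by apply: le_trans (le (fun=> false)); apply: esum_ge0 => q _; rewrite lee_fin.
have hE : holder_norm beta f = (fine (holder_norm beta f))%:E.
  by rewrite fineK // ge0_fin_numE.
exists (fine (holder_norm beta f)) => //; split; first by rewrite -lee_fin -hE.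
move=> w; split=> [N|q]; rewrite -lee_fin -hE; apply: le_trans (le w).
  exact: (@esum_lattice_box R (t w) N (t0 w)).
exact: (@le_esum_term R (t w) q (t0 w)).
Qed.

Lemma correlation_le A B w n beta f g (delta : R) :
  0 < beta -> 0 < delta -> strong_holder beta f -> strong_holder beta g ->
  (forall q : 'cV[int]_2, q != 0 ->
     delta <= enorm (real_mx R q) * enorm (real_mx R ((cocycle A B w n)^T *m q))) ->
  ((Normc.normc (corr A B f g w n))%:E <=
     holder_norm beta f * holder_norm beta g * (delta `^ (- beta))%:E)%E /\
  ((Normc.normc (skew_corr A B f g w n))%:E <=
     holder_norm beta f * holder_norm beta g * (delta `^ (- beta))%:E)%E.
Proof.
move=> beta0 delta0 sf sg hd.
have [a -> [a0 ha]] := strong_holder_normE sf.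
have [b -> [b0 hb]] := strong_holder_normE sg.
case: sf => [_ _ cf]; case: sg => [og _ _].
have cv w' x : Normc.normc (f (w', x) -
    \sum_(q <- lattice_box N) fourier f w' q * cexp (dot q x)) @[N --> \oo] --> (0 : R).
  by have := cf w' x; under eq_fun do rewrite fourier_partial_sumE.
have ig := (og w).2.
(* The sequence at which [f] is taken is chosen independently of the one driving the cocycle:
   [w' = w] gives [corr], and the shifted sequence gives [skew_corr]. *)
have key w' := torus_mean_correlation (F := fun x => f (w', x))
  (cv w') ig beta0 delta0 (ha w').1 (hb w).2 hd.
rewrite -!EFinM !lee_fin; split.
  by rewrite /corr -fourier0; exact: key.
rewrite /skew_corr -fourier0.
under [X in torus_mean X]eq_fun do rewrite iter_skewE.
exact: key.
Qed.

Lemma powR_Nexp (k s beta : R) : 0 < k ->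
  (k * expR s) `^ (- beta) = k `^ (- beta) * expR (- (s * beta)).
Proof.
move=> k0; rewrite powRM ?expR_ge0 ?ltW //; congr (_ * _).
by rewrite -expRM mulrN.
Qed.

End Correlations.

(** * Choice of the constants and conclusion *)

Theorem theorem5 (R : realType) (A B : 'M[int]_2) (lamE lamC : R)
    (p : R) (P : probability Omega R)
    (hA : hyperbolic_toral R A) (hB : hyperbolic_toral R B)
    (hcone : cone_property A B lamE lamC)
    (hp : 0 < p < 1) (hP : bernoulli_product p P) :
  exists c rho : R,
    [/\ 0 < c, 0 < rho, rho = ln (Num.min lamC^-1 lamE),
      (forall (beta : R) (f g : Omega * 'cV[R]_2 -> R[i]),
         0 < beta <= 1 -> strong_holder beta f -> strong_holder beta g ->
         forall n : nat,
           (ereal_sup [set (Normc.normc (corr A B f g w n))%:E | w in [set: Omega]] <=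
              c%:E * holder_norm beta f * holder_norm beta g *
              (expR (- (rho * beta * n%:R)))%:E)%E /\
           (ereal_sup [set (Normc.normc (skew_corr A B f g w n))%:E
                      | w in [set: Omega]] <=
              c%:E * holder_norm beta f * holder_norm beta g *
              (expR (- (rho * beta * n%:R)))%:E)%E)
    & forall chi2 : R, top_lyapunov_exponent A B P chi2 ->
        [/\ 0 < chi2,
            ln (Num.max lamC^-1 lamE) <= chi2
          & forall eps : R, 0 < eps ->
              exists C : Omega -> R, (forall w, 0 < C w) /\
              {ae P, forall w,
                forall (beta : R) (f g : Omega * 'cV[R]_2 -> R[i]),
                  0 < beta <= 1 -> strong_holder beta f -> strong_holder beta g ->
                  forall n : nat,
                    ((Normc.normc (corr A B f g w n))%:E <=
                       c%:E * holder_norm beta f * holder_norm beta g *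
                       (C w `^ (- beta))%:E *
                       (expR (- ((chi2 - eps) * beta * n%:R)))%:E)%E /\
                    ((Normc.normc (skew_corr A B f g w n))%:E <=
                       c%:E * holder_norm beta f * holder_norm beta g *
                       (C w `^ (- beta))%:E *
                       (expR (- ((chi2 - eps) * beta * n%:R)))%:E)%E}]].
Proof.
have [dA dB] : \det A = 1 /\ \det B = 1 by case: hA; case: hB.
have [kap kap0 hkap] := cone_dual_orbit_ge dA dB hcone.
have grow w n := absum_cocycle_ge w n dA dB hcone.
case: (hcone) => lE [/andP[lC0 lC1] _].
have iC1 : 1 < lamC^-1 by rewrite invf_gt1.
set lmin := Num.min lamC^-1 lamE; set lmax := Num.max lamC^-1 lamE.
have lmin1 : 1 < lmin by rewrite lt_min iC1.
have lmax1 : 1 < lmax by rewrite lt_max iC1.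
have lmm : lmin <= lmax by rewrite ge_min !le_max lexx.
have lmin0 : 0 < lmin by rewrite (lt_trans ltr01).
(* The value [2 / kap] serves the uniform estimate, where [1 <= c] and [beta <= 1] bound the power
   of [c] by [c]; the almost sure estimate uses only [1 <= c], as [kap] is absorbed into the random
   constant. *)
pose c := Num.max 1 (2 / kap).
have c1 : 1 <= c by rewrite le_max lexx.
have c0 : 0 < c by rewrite (lt_le_trans ltr01).
exists c, (ln lmin); split=> //; first exact: ln_gt0.
  move=> beta f g /andP[beta0 beta1] sf sg n.
  have bnd w : ((Normc.normc (corr A B f g w n))%:E <= c%:E * holder_norm beta f * holder_norm beta g *
              (expR (- (ln lmin * beta * n%:R)))%:E)%E /\
      ((Normc.normc (skew_corr A B f g w n))%:E <= c%:E * holder_norm beta f * holder_norm beta g *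
              (expR (- (ln lmin * beta * n%:R)))%:E)%E.
    (* Halving [kap] compensates the factor 2 in [grow]. *)
    pose delta := kap / 2 * expR (ln lmin * n%:R).
    have delta0 : 0 < delta by rewrite !mulr_gt0 ?expR_gt0 ?invr_gt0.
    have hd (q : 'cV[int]_2) : q != 0 ->
        delta <= enorm (real_mx R q) * enorm (real_mx R ((cocycle A B w n)^T *m q)).
      move=> q0; apply: le_trans (hkap w n q q0).
      rewrite /delta -mulrA ler_wpM2l ?(ltW kap0) // ler_pdivrMl //.
      apply: le_trans (grow w n); rewrite mulrC expRM_natl lnK ?posrE //.
      by rewrite lerXn2r ?nnegrE ?(ltW lmin0) // (le_trans (ltW lmin0)).
    have [h1 h2] := correlation_le beta0 delta0 sf sg hd.
    have [a ea [a0 _]] := strong_holder_normE sf.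
    have [b eb [b0 _]] := strong_holder_normE sg.
    have le : (holder_norm beta f * holder_norm beta g * (delta `^ (- beta))%:E <=
       c%:E * holder_norm beta f * holder_norm beta g *
              (expR (- (ln lmin * beta * n%:R)))%:E)%E.
      rewrite ea eb -!EFinM lee_fin powR_Nexp ?divr_gt0 //.
      rewrite (mulrAC (ln lmin) beta); move: (expR_ge0 (- (ln lmin * n%:R * beta))).
      move: (expR _) => e e0; have -> : c * a * b * e = a * b * (c * e) by ring.
      rewrite ler_wpM2l ?mulr_ge0 // ler_wpM2r //.
      have -> : (kap / 2) `^ (- beta) = (2 / kap) `^ beta.
        have k2 : 0 <= kap / 2 by rewrite divr_ge0 // ltW.
        by rewrite -[2 / kap]invf_div -(powR_inv1 k2) -powRrM mulN1r.
      apply: (@le_trans _ _ (c `^ beta)).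
        rewrite ge0_ler_powR ?nnegrE ?(ltW beta0) ?(ltW c0) //; first by rewrite divr_ge0 // ltW.
        by rewrite le_max lexx orbT.
      by rewrite -[leRHS]powRr1 ?(ltW c0) // ler_powR.
    by split; [exact: le_trans h1 le | exact: le_trans h2 le].
  by split; apply: ge_ereal_sup => _ [w _ <-]; case: (bnd w).
move=> chi top.
have P0 : (0 < P [set: Omega])%E by rewrite probability_setT lte_fin.
(* As [chi] is the same for almost all sequences, a single typical one yields the lower bounds on
   it. *)
have [w0 [L [oL eL mL]]] := @filter_ex _ _ (ae_properfilter_algebraOfSetsType P0) _ top.
have lchi : lmax <= expR chi.
  by apply: (growth_rate_le_lyapunov dA dB oL eL mL _ _ (grow w0)) => //; exact: ltW.
split.
- by rewrite -expR_gt1 (lt_le_trans lmax1).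
- by rewrite -(expRK chi) ler_ln ?posrE ?expR_gt0 // (lt_trans ltr01).
move=> eps eps0.
(* The constant depends on the sequence; where the Oseledets limit fails to give [chi] it takes the
   default value 1. *)
have ex w : exists C : R, 0 < C /\ ((exists L : 'M[R]_2,
     [/\ oseledets_limit A B w L, eigenvalue L (expR chi)
       & forall chi', eigenvalue L (expR chi') -> chi' <= chi]) ->
    forall n, C * expR ((chi - eps) * n%:R) <= absum (real_mx R (cocycle A B w n))).
  have [[L' [oL' eL' mL']]|no] := pselect (exists L : 'M[R]_2,
     [/\ oseledets_limit A B w L, eigenvalue L (expR chi)
       & forall chi', eigenvalue L (expR chi') -> chi' <= chi]).
    by have [C C0 hC] := lyapunov_growth dA dB oL' eL' mL' eps0; exists C.
  by exists 1.
have [C hC] := boolp.choice ex.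
exists (fun w => kap * C w); split; first by move=> w; rewrite mulr_gt0 ?(hC w).1.
apply: filterS top => w good beta f g /andP[beta0 beta1] sf sg n.
have Cw0 : 0 < kap * C w by rewrite mulr_gt0 ?(hC w).1.
pose delta := kap * C w * expR ((chi - eps) * n%:R).
have delta0 : 0 < delta by rewrite mulr_gt0 ?expR_gt0.
have hd (q : 'cV[int]_2) : q != 0 ->
    delta <= enorm (real_mx R q) * enorm (real_mx R ((cocycle A B w n)^T *m q)).
  move=> q0; apply: le_trans (hkap w n q q0).
  by rewrite /delta -mulrA ler_wpM2l ?(ltW kap0) ?(hC w).2.
have [h1 h2] := correlation_le beta0 delta0 sf sg hd.
have [a ea [a0 _]] := strong_holder_normE sf.
have [b eb [b0 _]] := strong_holder_normE sg.
have le : (holder_norm beta f * holder_norm beta g * (delta `^ (- beta))%:E <=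
   c%:E * holder_norm beta f * holder_norm beta g * ((kap * C w) `^ (- beta))%:E *
          (expR (- ((chi - eps) * beta * n%:R)))%:E)%E.
  rewrite ea eb -!EFinM lee_fin powR_Nexp // (mulrAC (chi - eps) beta) -!mulrA.
  by rewrite ler_peMl // !mulr_ge0 ?powR_ge0 ?expR_ge0.
by split; [exact: le_trans h1 le | exact: le_trans h2 le].
Qed.
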